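(* Let $I$ be an infinite set and $\{H_i\}_{i\in I}$ a family of non-zero complex inner-product spaces. (a) For every $\mu\in\Omega^{\rm un}_{I;H}$, the restriction of $\langle\cdot,\cdot\rangle_{\phi_1}$ to $\bigotimes^\mu_{i\in I}H_i\times\bigotimes^\mu_{i\in I}H_i$ coincides with the inner product on $\bigotimes^\mu_{i\in I}H_i$ determined by $\langle\otimes_{i\in I}x_i,\otimes_{i\in I}y_i\rangle=\prod_{i\in I}\langle x_i,y_i\rangle$ ($x,y\in\prod^\mu_{i\in I}H_i$). (b) $\langle\cdot,\cdot\rangle_{\phi_1}$ is a positive sesquilinear form on $\bigotimes^{\rm ct}_{i\in I}H_i$ and is an inner product on $\bigotimes^{\rm un}_{i\in I}H_i$. Moreover, if $$K:=\Big\{y\in\bigotimes^{\rm ct}_{i\in I}H_i:\langle x,y\rangle_{\phi_1}=0\ \text{ for all }x\in\bigotimes^{\rm ct}_{i\in I}H_i\Big\},$$ then $\bigotimes^{\rm ct}_{i\in I}H_i=K\oplus\bigotimes^{\rm un}_{i\in I}H_i$ (as vector spaces). (c) If $I=I_1\cup I_2$ with $I_1,I_2$ non-empty and $I_1\cap I_2=\emptyset$, then $\bigotimes^{\rm un}_{i\in I}H_i=\big(\bigotimes^{\rm un}_{i\in I_1}H_i\big)\otimes\big(\bigotimes^{\rm un}_{j\in I_2}H_j\big)$ as inner-product spaces, via the canonical isomorphism $\bigotimes_{i\in I}H_i\cong\big(\bigotimes_{i\in I_1}H_i\big)\otimes\big(\bigotimes_{j\in I_2}H_j\big)$.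
   Context: $\bigotimes_{i\in I}X_i$ is the vector space with a multilinear (linear in each variable separately) map $\Theta_X:x\mapsto\otimes_{i\in I}x_i$ from $\prod_{i\in I}X_i$ through which every multilinear map on $\prod_{i\in I}X_i$ factors via a unique linear map; it exists and is unique up to isomorphism. $\mathbb C^{\otimes I}=\bigotimes_{i\in I}\mathbb C$ is a $^*$-algebra with coordinatewise operations on elementary tensors and acts on $\bigotimes_{i\in I}H_i$ by $(\otimes\alpha_i)(\otimes x_i)=\otimes\alpha_ix_i$. $\mathfrak S_1(H_i)=\{x\in H_i:\|x\|=1\}$ and $B_1(H_i)=\{x\in H_i:\|x\|\le1\}$. For $x,y\in\prod_{i\in I}(H_i\setminus\{0\})$, $x\sim y$ means $x_i=y_i$ for all but finitely many $i$; $\Omega^{\rm un}_{I;H}=\prod_{i\in I}\mathfrak S_1(H_i)/\sim$. For $\mu=[u]_\sim$, $\prod^\mu_{i\in I}H_i=\{x\in\prod_{i\in I}H_i:x_i=u_i\text{ for all but finitely many }i\}$ and $\bigotimes^\mu_{i\in I}H_i=\mathrm{span}\,\Theta_H(\prod^\mu_{i\in I}H_i)$. Put $\bigotimes^{\rm ct}_{i\in I}H_i=\mathrm{span}\,\Theta_H(\prod_{i\in I}B_1(H_i))$ and $\bigotimes^{\rm un}_{i\in I}H_i=\mathrm{span}\,\Theta_H(\prod_{i\in I}\mathfrak S_1(H_i))$ (the same definitions, including the form below, are used with $I$ replaced by $I_1$, $I_2$, which may be finite). $\langle\cdot,\cdot\rangle_{\mathbb C^{\otimes I}}$ is the $\mathbb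 C^{\otimes I}$-valued form on $\bigotimes_{i\in I}H_i$, $\mathbb C^{\otimes I}$-linear in the first variable and with $\langle x,y\rangle^*_{\mathbb C^{\otimes I}}=\langle y,x\rangle_{\mathbb C^{\otimes I}}$, such that $\langle\otimes x_i,\otimes y_i\rangle_{\mathbb C^{\otimes I}}=\otimes_{i\in I}\langle x_i,y_i\rangle$. $\phi_1:\mathbb C^{\otimes I}\to\mathbb C$ is the linear functional with $\phi_1(\otimes\beta_i)=\prod_{i\in I}\beta_i$ if $\beta_i=1$ for all but finitely many $i$ and $\phi_1(\otimes\beta_i)=0$ otherwise. Finally, $\langle\xi,\eta\rangle_{\phi_1}=\phi_1(\langle\xi,\eta\rangle_{\mathbb C^{\otimes I}})$ for $\xi,\eta\in\bigotimes_{i\in I}H_i$. *)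

(* Defs.v *)
From HB Require Import structures.
From mathcomp Require Import all_boot all_order all_algebra.
From mathcomp Require Import finmap complex.
From mathcomp Require Import boolp classical_sets functions cardinality fsbigop.
From mathcomp Require Import reals.

Set Implicit Arguments.
Unset Strict Implicit.
Unset Printing Implicit Defensive.

Import Order.TTheory GRing.Theory Num.Theory.
Local Open Scope classical_set_scope.
Local Open Scope ring_scope.

(* Conjugate space: same additive group, scalars act through conjugation, so *)
(* that semilinear maps into V are the linear maps into conjmod V.           *)
Section ConjugateModule.
Variables (C : numClosedFieldType) (V : lmodType C).

Definition conjmod : Type := V.
HB.instance Definition _ := GRing.Zmodule.on conjmod.

Definition conjscale (a : C) (v : conjmod) : conjmod := a^* *: (v : V).

Lemma conjscaleA a b v : conjscale a (conjscale b v) = conjscale (a * b) v.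
Proof. by rewrite /conjscale scalerA rmorphM. Qed.
Lemma conjscale1 : left_id 1 conjscale.
Proof. by move=> v; rewrite /conjscale rmorph1 scale1r. Qed.
Lemma conjscaleDr : right_distributive conjscale +%R.
Proof. by move=> a u v; rewrite /conjscale scalerDr. Qed.
Lemma conjscaleDl v : {morph conjscale^~ v : a b / a + b}.
Proof. by move=> a b; rewrite /conjscale rmorphD scalerDl. Qed.

HB.instance Definition _ := GRing.Zmodule_isLmodule.Build C conjmod
  conjscaleA conjscale1 conjscaleDr conjscaleDl.

Lemma conjscaleE (a : C) (v : conjmod) : a *: v = (a^* *: (v : V)) :> V.
Proof. by []. Qed.
End ConjugateModule.

Section LinearSpan.
Variables (K : nzRingType) (V : lmodType K).

Definition span (A : set V) : {pred V} := fun v =>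
  `[< exists n (a : 'I_n -> K) (x : 'I_n -> V),
      (forall k, A (x k)) /\ v = \sum_k a k *: x k >].

Lemma spanP (A : set V) v : reflect
  (exists n (a : 'I_n -> K) (x : 'I_n -> V),
      (forall k, A (x k)) /\ v = \sum_k a k *: x k)
  (v \in span A).
Proof. exact: asboolP. Qed.

Lemma mem_span (A : set V) v : A v -> v \in span A.
Proof.
move=> Av; apply/spanP; exists 1%N, (fun=> 1), (fun=> v); split=> //.
by rewrite big_ord1 scale1r.
Qed.

Lemma span_submod_closed (A : set V) : submod_closed (span A).
Proof.
split=> [|c u v].
  by apply/spanP; exists 0%N, (fun=> 0), (fun=> 0); split; [case|rewrite big_ord0].
move=> /spanP[n [a [x [Ax ->]]]] /spanP[m [b [y [Ay ->]]]]; apply/spanP.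
exists (n + m)%N, (fun k : 'I_(n + m) => match fintype.split k with inl i => c * a i | inr j => b j end),
  (fun k : 'I_(n + m) => match fintype.split k with inl i => x i | inr j => y j end).
split=> [k|]; first by case: fintype.split.
rewrite big_split_ord /= scaler_sumr; congr (_ + _); apply: eq_bigr => i _.
  by rewrite -[lshift m i]/(unsplit (inl i)) unsplitK scalerA.
by rewrite -[rshift n i]/(unsplit (inr i)) unsplitK.
Qed.

HB.instance Definition _ (A : set V) :=
  GRing.isSubmodClosed.Build K V (span A) (span_submod_closed A).

Record span_space (A : set V) := SpanSpace {
  span_val : V;
  _ : span_val \in span A }.

HB.instance Definition _ (A : set V) := [isSub for @span_val A].
HB.instance Definition _ (A : set V) := [Choice of span_space A by <:].
HB.instance Definition _ (A : set V) :=
  [SubChoice_isSubLmodule of span_space A by <:].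
End LinearSpan.

Section Tensor.
Variables (C : numClosedFieldType) (I : choiceType).

Definition multilinear (X : I -> lmodType C) (V : lmodType C)
    (M : (forall i, X i) -> V) : Prop :=
  forall (x : forall i, X i) (i : I) (a : C) (u v : X i),
    M (dfwith x (a *: u + v)) = a *: M (dfwith x u) + M (dfwith x v).

(* The tensor product of the family X consists of formal linear combinations *)
(* of points of the product, two of them being identified when no            *)
(* multilinear map distinguishes them; tens_universal is the universal       *)
(* property.                                                                 *)
Section Construction.
Variable X : I -> lmodType C.

Definition formal : Type := {classic seq (C * (forall i, X i))}.
HB.instance Definition _ := Choice.on formal.

Definition feval (V : lmodType C) (M : (forall i, X i) -> V) (s : formal) : V :=
  \sum_(p <- (s : seq (C * (forall i, X i)))) p.1 *: M p.2.

Definition formal_eq (s t : formal) : bool :=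
  `[< forall (V : lmodType C) (M : (forall i, X i) -> V),
        multilinear M -> feval M s = feval M t >].

Lemma formal_eq_refl : reflexive formal_eq.
Proof. by move=> s; apply/asboolP. Qed.
Lemma formal_eq_sym : symmetric formal_eq.
Proof.
by move=> s t; apply/asboolP/asboolP => st V M mM; rewrite st.
Qed.
Lemma formal_eq_trans : transitive formal_eq.
Proof.
by move=> s t u /asboolP ts /asboolP su; apply/asboolP => V M mM; rewrite ts ?su.
Qed.
Canonical formal_equiv :=
  EquivRel formal_eq formal_eq_refl formal_eq_sym formal_eq_trans.

Definition tens : Type := {eq_quot formal_equiv}%qT.
HB.instance Definition _ := Choice.on tens.
HB.instance Definition _ := EqQuotient.on tens.

Definition mktens (s : seq (C * (forall i, X i))) : tens :=
  (\pi_tens (s : formal))%qT.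

Definition tensp (x : forall i, X i) : tens := mktens [:: (1, x)].

(* Only meaningful when M is multilinear. *)
Definition tens_lift (V : lmodType C) (M : (forall i, X i) -> V) (t : tens) : V :=
  feval M (repr t).

Lemma tens_lift_mk (V : lmodType C) (M : (forall i, X i) -> V) s :
  multilinear M -> tens_lift M (mktens s) = \sum_(p <- s) p.1 *: M p.2.
Proof.
move=> mM; rewrite /tens_lift /mktens.
have /eqmodP/asboolP -> // := reprK (\pi_tens (s : formal))%qT.
Qed.

Lemma tens_ext (t u : tens) :
  (forall (V : lmodType C) (M : (forall i, X i) -> V),
     multilinear M -> tens_lift M t = tens_lift M u) -> t = u.
Proof.
by move=> tu; rewrite -[t]reprK -[u]reprK; apply/eqmodP/asboolP => V M /tu.
Qed.

Definition tens_add (t u : tens) : tens :=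
  mktens ((repr t : seq _) ++ (repr u : seq _)).
Definition tens_scale (a : C) (t : tens) : tens :=
  mktens [seq (a * p.1, p.2) | p <- (repr t : seq _)].

Lemma tens_lift_add (V : lmodType C) (M : (forall i, X i) -> V) t u :
  multilinear M -> tens_lift M (tens_add t u) = tens_lift M t + tens_lift M u.
Proof. by move=> mM; rewrite tens_lift_mk// big_cat. Qed.

Lemma tens_lift_scale (V : lmodType C) (M : (forall i, X i) -> V) a t :
  multilinear M -> tens_lift M (tens_scale a t) = a *: tens_lift M t.
Proof.
move=> mM; rewrite tens_lift_mk// big_map scaler_sumr.
by apply: eq_bigr => p _; rewrite scalerA.
Qed.

Lemma tens_lift_nil (V : lmodType C) (M : (forall i, X i) -> V) :
  multilinear M -> tens_lift M (mktens [::]) = 0.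
Proof. by move=> mM; rewrite tens_lift_mk// big_nil. Qed.

Lemma tens_addA : associative tens_add.
Proof. by move=> t u v; apply: tens_ext => V M mM; rewrite !tens_lift_add// addrA. Qed.
Lemma tens_addC : commutative tens_add.
Proof. by move=> t u; apply: tens_ext => V M mM; rewrite !tens_lift_add// addrC. Qed.
Lemma tens_add0 : left_id (mktens [::]) tens_add.
Proof.
by move=> t; apply: tens_ext => V M mM; rewrite tens_lift_add// tens_lift_nil// add0r.
Qed.
Lemma tens_addN : left_inverse (mktens [::]) (tens_scale (- 1)) tens_add.
Proof.
move=> t; apply: tens_ext => V M mM.
by rewrite tens_lift_add// tens_lift_scale// tens_lift_nil// scaleN1r addNr.
Qed.
HB.instance Definition _ :=
  GRing.isZmodule.Build tens tens_addA tens_addC tens_add0 tens_addN.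

Lemma tens_scaleA a b t : tens_scale a (tens_scale b t) = tens_scale (a * b) t.
Proof. by apply: tens_ext => V M mM; rewrite !tens_lift_scale// scalerA. Qed.
Lemma tens_scale1 : left_id 1 tens_scale.
Proof. by move=> t; apply: tens_ext => V M mM; rewrite tens_lift_scale// scale1r. Qed.
Lemma tens_scaleDr : right_distributive tens_scale +%R.
Proof.
move=> a t u; apply: tens_ext => V M mM.
by rewrite !(tens_lift_scale, tens_lift_add)// scalerDr.
Qed.
Lemma tens_scaleDl t : {morph tens_scale^~ t : a b / a + b}.
Proof.
move=> a b; apply: tens_ext => V M mM.
by rewrite !(tens_lift_scale, tens_lift_add)// scalerDl.
Qed.
HB.instance Definition _ := GRing.Zmodule_isLmodule.Build C tens
  tens_scaleA tens_scale1 tens_scaleDr tens_scaleDl.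

Lemma tens_lift_linear (V : lmodType C) (M : (forall i, X i) -> V) :
  multilinear M -> linear (tens_lift M).
Proof. by move=> mM a t u; rewrite tens_lift_add// tens_lift_scale. Qed.

Lemma tens_lift_tensp (V : lmodType C) (M : (forall i, X i) -> V) x :
  multilinear M -> tens_lift M (tensp x) = M x.
Proof. by move=> mM; rewrite tens_lift_mk// big_seq1 scale1r. Qed.

Lemma tensp_multilinear : multilinear tensp.
Proof.
move=> x i a u v; apply: tens_ext => V M mM.
by rewrite tens_lift_add// tens_lift_scale// !tens_lift_tensp.
Qed.

Lemma tens_span (t : tens) : t = \sum_(p <- (repr t : seq _)) p.1 *: tensp p.2.
Proof.
apply: tens_ext => V M mM; rewrite {1}/tens_lift /feval.
pose L : {linear tens -> V} := HB.pack (tens_lift M)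
  (GRing.isLinear.Build _ _ _ _ _ (tens_lift_linear mM)).
rewrite -[RHS]/(L _) linear_sum; apply: eq_bigr => p _.
by rewrite linearZ /= tens_lift_tensp.
Qed.

Lemma tens_linear_ext (V : lmodType C) (f g : tens -> V) :
  linear f -> linear g -> (forall x, f (tensp x) = g (tensp x)) -> f =1 g.
Proof.
move=> lf lg fg t.
pose F : {linear tens -> V} := HB.pack f (GRing.isLinear.Build _ _ _ _ _ lf).
pose G : {linear tens -> V} := HB.pack g (GRing.isLinear.Build _ _ _ _ _ lg).
rewrite -[LHS]/(F t) -[RHS]/(G t) [t]tens_span !linear_sum.
by apply: eq_bigr => p _; rewrite !linearZ /= fg.
Qed.

Theorem tens_universal :
  multilinear tensp /\
  forall (V : lmodType C) (M : (forall i, X i) -> V), multilinear M ->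
    exists2 L : tens -> V,
      linear L /\ (forall x, L (tensp x) = M x)
      & forall L' : tens -> V,
          linear L' -> (forall x, L' (tensp x) = M x) -> L' =1 L.
Proof.
split=> [|V M mM]; first exact: tensp_multilinear.
exists (tens_lift M) => [|L' lL' eL'].
  by split=> [|x]; [exact: tens_lift_linear|rewrite tens_lift_tensp].
apply: tens_linear_ext => // [|x]; first exact: tens_lift_linear.
by rewrite tens_lift_tensp.
Qed.
End Construction.
End Tensor.

Section MultilinearMaps.
Variables (C : numClosedFieldType) (I : choiceType).

Lemma dfwith_map (X Y : I -> Type) (F : forall i, X i -> Y i)
    (x : forall i, X i) (i : I) (u : X i) :
  (fun j => F j (dfwith x u j)) = dfwith (fun j => F j (x j)) (F i u).
Proof.
apply: functional_extensionality_dep => j.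
case: dfwithP => [|k ik]; first by rewrite dfwith_in.
by rewrite dfwith_out.
Qed.

Lemma multilinear_map (X Y : I -> lmodType C) (V : lmodType C)
    (M : (forall i, Y i) -> V) (F : forall i, X i -> Y i) :
  (forall i, linear (F i)) -> multilinear M ->
  multilinear (fun x => M (fun i => F i (x i))).
Proof. by move=> lF mM x i a u v; rewrite !dfwith_map lF mM. Qed.

Definition scalar_fam : I -> lmodType C := fun=> C^o.
Definition ctens : lmodType C := tens scalar_fam.
Definition ctensp (b : I -> C) : ctens := tensp (b : forall i, scalar_fam i).

(* When finitely many b i differ from 1, the big operator is the product of  *)
(* those values.                                                             *)
Definition phi1_elem (b : I -> C) : C :=
  if `[< finite_set [set i | b i <> 1] >]
  then \big[*%R/1]_(i \in [set: I]) b i else 0.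

Definition phi1 : ctens -> C :=
  tens_lift (X := scalar_fam) (V := C^o) phi1_elem.

Lemma phi1_elem_dfwith (b : forall i, scalar_fam i) (i : I) (u : C^o) :
  phi1_elem (dfwith b (u : scalar_fam i)) =
  u * phi1_elem (dfwith b (1 : scalar_fam i)).
Proof.
have fin w : finite_set [set j | dfwith b (w : scalar_fam i) j <> 1] <->
    finite_set [set j | j <> i /\ b j <> 1].
  split=> fs.
    apply: sub_finite_set fs => j [/= ji bj].
    by rewrite dfwith_out// eq_sym; apply/eqP.
  apply: (@sub_finite_set _ _ ([set i] `|` [set j | j <> i /\ b j <> 1])).
    move=> j /=; have [->|/eqP ji] := eqVneq j i; first by left.
    by rewrite dfwith_out 1?eq_sym//; [right|apply/eqP].
  by rewrite finite_setU; split=> //; exact: finite_set1.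
rewrite /phi1_elem.
have [f1|n1] := pselect (finite_set [set j | j <> i /\ b j <> 1]); last first.
  by rewrite !asboolF ?mulr0// fin.
rewrite !asboolT ?fin//.
have [A hA] := finite_fsetP.1 f1.
have out w j : j \notin (i |` A)%fset -> dfwith b (w : scalar_fam i) j = 1.
  rewrite !inE negb_or => /andP[ji jA]; rewrite dfwith_out 1?eq_sym//.
  apply: contrapT => bj; move/negP: jA; apply.
  have : [set j | j <> i /\ b j <> 1] j by split=> //; apply/eqP.
  by rewrite hA.
have iA : i \notin A.
  apply/negP => iA; have : [set` A] i by [].
  by rewrite -hA => -[].
rewrite !(@fsbigTE _ _ _ _ (i |` A)%fset); try by move=> j; exact: out.
rewrite !big_fsetU1//= !dfwith_in mul1r; congr (_ * _).
apply: eq_big_seq => j jA; rewrite !dfwith_out//; apply: contraNneq iA => ->; exact: jA.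
Qed.

Lemma phi1_multilinear :
  multilinear (X := scalar_fam) (V := C^o) phi1_elem.
Proof.
move=> b i a u v.
rewrite phi1_elem_dfwith [phi1_elem (dfwith b u)]phi1_elem_dfwith.
by rewrite [phi1_elem (dfwith b v)]phi1_elem_dfwith mulrDl -mulrA.
Qed.

Lemma phi1_linear : linear (phi1 : ctens -> C^o).
Proof. exact: tens_lift_linear phi1_multilinear. Qed.

Lemma phi1_ctensp (b : I -> C) : phi1 (ctensp b) = phi1_elem b.
Proof. exact: tens_lift_tensp phi1_multilinear. Qed.

Definition ctens_star : ctens -> ctens :=
  tens_lift (X := scalar_fam) (V := conjmod ctens) (fun b => ctensp (fun i => (b i)^*)).

(* For X = scalar_fam this is the product of ctens. *)
Definition ctens_act (X : I -> lmodType C) (t : ctens) (xi : tens X) : tens X :=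
  tens_lift (X := scalar_fam)
    (fun b => tens_lift (fun x => tensp (fun i => (b i : C) *: x i)) xi) t.

Lemma ctens_star_multilinear :
  multilinear (X := scalar_fam) (V := conjmod ctens)
    (fun b => ctensp (fun i => (b i)^*)).
Proof.
move=> b i a u v.
pose F (j : I) (c : scalar_fam j) : scalar_fam j := (c : C)^*.
have FE w : ctensp (fun j => (dfwith b w j : C)^*) =
    tensp (dfwith (fun j => F j (b j)) (F i w)) by rewrite -(dfwith_map F).
rewrite !FE conjscaleE.
have -> : F i (a *: u + v) = a^* *: F i u + F i v.
  by rewrite /F rmorphD rmorphM.
by rewrite tensp_multilinear.
Qed.

Lemma ctens_star_linear (a : C) (t u : ctens) :
  ctens_star (a *: t + u) = a^* *: ctens_star t + ctens_star u.
Proof. exact: (tens_lift_linear ctens_star_multilinear a t u). Qed.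

Lemma ctens_star_tensp (b : I -> C) :
  ctens_star (ctensp b) = ctensp (fun i => (b i)^*).
Proof. exact: (tens_lift_tensp _ ctens_star_multilinear). Qed.

Lemma multilinear_sum (X : I -> lmodType C) (V : lmodType C) (T : Type)
    (s : seq T) (c : T -> C) (B : T -> (forall i, X i) -> V) :
  (forall p, multilinear (B p)) ->
  multilinear (fun x => \sum_(p <- s) c p *: B p x).
Proof.
move=> mB x i a u v; rewrite scaler_sumr -big_split/=; apply: eq_bigr => p _.
by rewrite mB scalerDr !scalerA mulrC.
Qed.

Lemma ctens_act_inner (X : I -> lmodType C) (b : I -> C) :
  multilinear (fun x : forall i, X i => tensp (fun i => b i *: x i)).
Proof.
apply: (multilinear_map (F := fun i (xi : X i) => b i *: xi)).
  by move=> i a u v; rewrite scalerDr !scalerA mulrC.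
exact: tensp_multilinear.
Qed.

Lemma ctens_act_outer (X : I -> lmodType C) (xi : tens X) :
  multilinear (X := scalar_fam)
    (fun b => tens_lift (fun x => tensp (fun i => (b i : C) *: x i)) xi).
Proof.
apply: (@multilinear_sum scalar_fam _ _ _ (fun p => p.1)
  (fun p b => tensp (fun i => (b i : C) *: (p.2 i : X i)))) => p.
apply: (multilinear_map (X := scalar_fam)
  (F := fun i (c : scalar_fam i) => (c : C) *: (p.2 i : X i))).
  by move=> i a u v; rewrite scalerDl scalerA.
exact: tensp_multilinear.
Qed.

Lemma ctens_act_linear (X : I -> lmodType C) (t : ctens) :
  linear (ctens_act (X := X) t).
Proof.
have lA z : linear ((@ctens_act X)^~ z).
  exact: tens_lift_linear (ctens_act_outer _).
move=> a xi eta; move: t.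
apply: (tens_linear_ext (lA (a *: xi + eta))) => [c s t|b].
  by rewrite !lA !scalerDr !scalerA [a * c]mulrC addrACA.
rewrite /ctens_act !tens_lift_tensp; try exact: ctens_act_outer.
exact: (tens_lift_linear (ctens_act_inner _)).
Qed.

Lemma ctens_act_linearl (X : I -> lmodType C) (xi : tens X) :
  linear ((@ctens_act X)^~ xi).
Proof. exact: tens_lift_linear (ctens_act_outer _). Qed.

Lemma ctens_act_tensp (X : I -> lmodType C) (b : I -> C) (x : forall i, X i) :
  ctens_act (ctensp b) (tensp x) = tensp (fun i => b i *: x i).
Proof.
rewrite /ctens_act tens_lift_tensp; last exact: ctens_act_outer.
by rewrite tens_lift_tensp//; exact: ctens_act_inner.
Qed.
End MultilinearMaps.
Arguments ctens C I : clear implicits.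
Arguments scalar_fam C I : clear implicits.

Section InnerProductSpaces.
Variables (C : numClosedFieldType) (I : choiceType).
Variables (H : I -> lmodType C) (ip : forall i, {dot (H i) for Num.conj}).

Definition ipnorm i (x : H i) : C := sqrtC (ip i x x).

Definition unit_vecs : set (forall i, H i) :=
  [set x | forall i, ipnorm (x i) = 1].
Definition ball_vecs : set (forall i, H i) :=
  [set x | forall i, ipnorm (x i) <= 1].

Definition almost_eq (x y : forall i, H i) : Prop :=
  finite_set [set i | x i <> y i].

(* The quotient of unit_vecs by almost_eq, as the set of its classes. *)
Definition Omega_un : set (set (forall i, H i)) :=
  [set mu | exists2 u, unit_vecs u & mu = [set v | unit_vecs v /\ almost_eq v u]].

Definition prod_mu (mu : set (forall i, H i)) : set (forall i, H i) :=
  [set x | exists2 u, mu u & almost_eq x u].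

Definition tens_mu (mu : set (forall i, H i)) : lmodType C :=
  span_space (@tensp C I H @` prod_mu mu).
Definition tens_ct : lmodType C := span_space (@tensp C I H @` ball_vecs).
Definition tens_un : lmodType C := span_space (@tensp C I H @` unit_vecs).

(* The inner lift, with values in conjmod, is semilinear in eta. The form is *)
(* characterized by ctens_form_tensp, ctens_form_actl and ctens_form_star.   *)
Definition ctens_form (xi eta : tens H) : ctens C I :=
  tens_lift (fun x : forall i, H i =>
    tens_lift (V := conjmod (ctens C I))
      (fun y => ctensp (fun i => ip i (x i) (y i))) eta : ctens C I) xi.

Definition phi1_form (xi eta : tens H) : C := phi1 (ctens_form xi eta).

(* g is given on elementary tensors by the product of the inner products;    *)
(* for x and y in prod_mu mu all but finitely many factors are 1.            *)
Definition is_product_form (mu : set (forall i, H i))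
    (g : tens_mu mu -> tens_mu mu -> C) : Prop :=
  forall (xi eta : tens_mu mu) (x y : forall i, H i),
    prod_mu mu x -> prod_mu mu y ->
    span_val xi = tensp x -> span_val eta = tensp y ->
    g xi eta = \big[*%R/1]_(i \in [set: I]) ip i (x i) (y i).

Definition ct_radical : set tens_ct :=
  [set y | forall x : tens_ct, phi1_form (span_val x) (span_val y) = 0].

Lemma ctens_form_inner (x : forall i, H i) :
  multilinear (V := conjmod (ctens C I))
    (fun y : forall i, H i => ctensp (fun i => ip i (x i) (y i))).
Proof.
move=> y i a u v.
have FE w : ctensp (fun j => ip j (x j) (dfwith y w j)) =
    tensp (dfwith (fun j => ip j (x j) (y j) : scalar_fam C I j)
                  (ip i (x i) w : scalar_fam C I i)).
  by rewrite -(dfwith_map (fun j z => ip j (x j) z : scalar_fam C I j)).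
rewrite !FE conjscaleE.
have -> : (ip i (x i) (a *: u + v) : scalar_fam C I i) =
    a^* *: (ip i (x i) u : scalar_fam C I i) + ip i (x i) v.
  by rewrite linearDr linearZr_LR.
by rewrite tensp_multilinear.
Qed.

Lemma ctens_form_outer (eta : tens H) :
  multilinear (fun x : forall i, H i =>
    tens_lift (V := conjmod (ctens C I))
      (fun y => ctensp (fun i => ip i (x i) (y i))) eta : ctens C I).
Proof.
apply: (@multilinear_sum _ _ H _ _ _ (fun p => p.1^*)
  (fun p x => ctensp (fun i => ip i (x i) (p.2 i : H i)))) => p x i a u v.
have FE w : ctensp (fun j => ip j (dfwith x w j) (p.2 j)) =
    tensp (dfwith (fun j => ip j (x j) (p.2 j) : scalar_fam C I j)
                  (ip i w (p.2 i) : scalar_fam C I i)).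
  by rewrite -(dfwith_map (fun j z => ip j z (p.2 j) : scalar_fam C I j)).
by rewrite !FE linearDl linearZl_LR tensp_multilinear.
Qed.

Lemma ctens_form_linearl (eta : tens H) : linear (ctens_form^~ eta).
Proof. exact: tens_lift_linear (ctens_form_outer _). Qed.

Lemma ctens_form_tensp (x y : forall i, H i) :
  ctens_form (tensp x) (tensp y) = ctensp (fun i => ip i (x i) (y i)).
Proof.
rewrite /ctens_form tens_lift_tensp; last exact: ctens_form_outer.
by rewrite tens_lift_tensp//; exact: ctens_form_inner.
Qed.

Lemma ctens_form_semilinearr (xi : tens H) (a : C) (eta zeta : tens H) :
  ctens_form xi (a *: eta + zeta) =
  a^* *: ctens_form xi eta + ctens_form xi zeta.
Proof.
move: xi; apply: (tens_linear_ext (ctens_form_linearl _)) => [c s t|x].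
  rewrite !ctens_form_linearl !scalerDr !scalerA [a^* * c]mulrC.
  by rewrite addrACA.
rewrite /ctens_form !tens_lift_tensp; try exact: ctens_form_outer.
exact: (tens_lift_linear (ctens_form_inner _)).
Qed.

Lemma ctens_form_star (xi eta : tens H) :
  ctens_star (ctens_form xi eta) = ctens_form eta xi.
Proof.
have lS t : linear ((fun s => ctens_star (ctens_form s t)) : tens H -> conjmod (ctens C I)).
  by move=> a u v; rewrite ctens_form_linearl ctens_star_linear.
move: xi; apply: (tens_linear_ext (lS eta)) => [a u v|x].
  exact: ctens_form_semilinearr.
have lT : linear (fun t : tens H => ctens_star (ctens_form (tensp x) t)).
  by move=> a u v; rewrite ctens_form_semilinearr ctens_star_linear conjCK.
move: eta; apply: (tens_linear_ext lT) => [a u v|y].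
  exact: ctens_form_linearl.
rewrite !ctens_form_tensp ctens_star_tensp; congr ctensp.
by apply: funext => i; rewrite [RHS]hermC expr0 mul1r.
Qed.

Lemma ctens_form_actl (t : ctens C I) (xi eta : tens H) :
  ctens_form (ctens_act t xi) eta = ctens_act t (ctens_form xi eta).
Proof.
move: t; apply: tens_linear_ext => [a u v|a u v|b].
- by rewrite ctens_act_linearl ctens_form_linearl.
- exact: ctens_act_linearl.
move: xi; apply: tens_linear_ext => [a u v|a u v|x].
- by rewrite ctens_act_linear ctens_form_linearl.
- by rewrite ctens_form_linearl ctens_act_linear.
move: eta; apply: (@tens_linear_ext _ _ _ (conjmod (ctens C I))) => [a u v|a u v|y].
- exact: ctens_form_semilinearr.
- by rewrite ctens_form_semilinearr ctens_act_linear.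
rewrite -[tensp b]/(ctensp b) ctens_act_tensp !ctens_form_tensp ctens_act_tensp.
by congr ctensp; apply: funext => i; rewrite linearZl_LR.
Qed.
End InnerProductSpaces.

Section Forms.
Variables (C : numClosedFieldType) (V : lmodType C) (f : V -> V -> C).

Definition is_inner_product : Prop :=
  exists g : {dot V for Num.conj}, forall x y, f x y = g x y.

Definition is_positive_sesquilinear : Prop :=
  (exists g : {bilinear V -> V -> C | *%R & Num.conj \; *%R},
     forall x y, f x y = g x y)
  /\ forall x, 0 <= f x x.
End Forms.

Section BinaryTensor.
Variable C : numClosedFieldType.

Definition pair_fam (V W : lmodType C) : bool -> lmodType C :=
  fun b => if b then V else W.

Definition pair_vec (V W : lmodType C) (v : V) (w : W) : forall b, pair_fam V W b :=
  fun b => match b return pair_fam V W b with true => v | false => w end.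

Definition tens2 (V W : lmodType C) : lmodType C := tens (pair_fam V W).

Definition tensp2 (V W : lmodType C) (v : V) (w : W) : tens2 V W :=
  tensp (pair_vec v w).

Lemma dfwith_pair_true (V W : lmodType C) (v v' : V) (w : W) :
  dfwith (pair_vec v w) (v' : pair_fam V W true) = pair_vec v' w.
Proof.
apply: functional_extensionality_dep => -[]; first by rewrite dfwith_in.
by rewrite dfwith_out.
Qed.

Lemma dfwith_pair_false (V W : lmodType C) (v : V) (w w' : W) :
  dfwith (pair_vec v w) (w' : pair_fam V W false) = pair_vec v w'.
Proof.
apply: functional_extensionality_dep => -[]; first by rewrite dfwith_out.
by rewrite dfwith_in.
Qed.

Lemma tensp2_linearl (V W : lmodType C) (w : W) :
  linear (fun v : V => tensp2 v w).
Proof.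
move=> a u v; have := @tensp_multilinear _ _ (pair_fam V W) (pair_vec u w) true a u v.
by rewrite !dfwith_pair_true.
Qed.

Lemma tensp2_linearr (V W : lmodType C) (v : V) :
  linear (fun w : W => tensp2 v w).
Proof.
move=> a u w; have := @tensp_multilinear _ _ (pair_fam V W) (pair_vec v u) false a u w.
by rewrite !dfwith_pair_false.
Qed.

Definition is_tensor2_form (V W : lmodType C) (f : V -> V -> C) (h : W -> W -> C)
    (g : tens2 V W -> tens2 V W -> C) : Prop :=
  forall (v v' : V) (w w' : W),
    g (tensp2 v w) (tensp2 v' w') = f v v' * h w w'.

Definition tens2_map (V V' W W' : lmodType C) (f : V -> V') (g : W -> W') :
    tens2 V W -> tens2 V' W' :=
  tens_lift (fun x : forall b, pair_fam V W b => tensp2 (f (x true)) (g (x false))).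

Lemma tens2_map_multilinear (V V' W W' : lmodType C)
    (f : {linear V -> V'}) (g : {linear W -> W'}) :
  multilinear
    (fun x : forall b, pair_fam V W b => tensp2 (f (x true)) (g (x false))).
Proof.
move=> x [] a u v.
  rewrite !dfwith_in !dfwith_out// [f _]linearP.
  exact: tensp2_linearl.
rewrite !dfwith_in !dfwith_out// [g _]linearP.
exact: tensp2_linearr.
Qed.

Lemma tens2_map_linear (V V' W W' : lmodType C)
    (f : {linear V -> V'}) (g : {linear W -> W'}) : linear (tens2_map f g).
Proof. exact: tens_lift_linear (tens2_map_multilinear f g). Qed.

Lemma tens2_map_tensp2 (V V' W W' : lmodType C)
    (f : {linear V -> V'}) (g : {linear W -> W'}) (v : V) (w : W) :
  tens2_map f g (tensp2 v w) = tensp2 (f v) (g w).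
Proof. exact: (tens_lift_tensp _ (tens2_map_multilinear f g)). Qed.
End BinaryTensor.

Definition sub_fam (C : numClosedFieldType) (I : choiceType) (H : I -> lmodType C)
  (A : set I) : A -> lmodType C := fun i => H (val i).
Arguments sub_fam {C I} H A _.

Definition sub_vec (C : numClosedFieldType) (I : choiceType) (H : I -> lmodType C)
  (A : set I) (x : forall i, H i) : forall i, sub_fam H A i := fun i => x (val i).
Arguments sub_vec {C I H} A x _.

Definition sub_ip (C : numClosedFieldType) (I : choiceType) (H : I -> lmodType C)
  (ip : forall i, {dot (H i) for Num.conj}) (A : set I)
  : forall i, {dot (sub_fam H A i) for Num.conj} := fun i => ip (val i).
Arguments sub_ip {C I H} ip A _.

Section Partition.
Variables (C : numClosedFieldType) (I : choiceType) (H : I -> lmodType C).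

Definition canonical_split (I1 I2 : set I) :
    tens H -> tens2 (tens (sub_fam H I1)) (tens (sub_fam H I2)) :=
  tens_lift (fun x : forall i, H i =>
    tensp2 (tensp (sub_vec I1 x)) (tensp (sub_vec I2 x))).

Lemma sub_vec_dfwith_in (A : set I) (x : forall i, H i) (i : A) (u : H (val i)) :
  sub_vec A (dfwith x u) = dfwith (sub_vec A x) (u : sub_fam H A i).
Proof.
apply: functional_extensionality_dep => j; rewrite /sub_vec.
case: (dfwithP (sub_vec A x) (u : sub_fam H A i) j) => [|k ik].
  by rewrite dfwith_in.
by rewrite dfwith_out// val_eqE.
Qed.

Lemma sub_vec_dfwith_out (A : set I) (x : forall i, H i) (i : I) (u : H i) :
  ~ A i -> sub_vec A (dfwith x u) = sub_vec A x.
Proof.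
move=> nAi; apply: functional_extensionality_dep => j; rewrite /sub_vec.
by rewrite dfwith_out//; apply/eqP => ij; apply: nAi; rewrite ij; exact: set_valP.
Qed.

Lemma canonical_split_multilinear (I1 I2 : set I) :
  I1 `|` I2 = [set: I] -> I1 `&` I2 = set0 ->
  multilinear
    (fun x : forall i, H i =>
       tensp2 (tensp (sub_vec I1 x)) (tensp (sub_vec I2 x))).
Proof.
move=> U12 D12 x i a u v.
have dis : I1 i -> I2 i -> False.
  by move=> i1 i2; have : (I1 `&` I2) i by []; rewrite D12.
have [i1|i2] : (I1 `|` I2) i by rewrite U12.
  rewrite !(sub_vec_dfwith_out (A := I2)); try by move=> /(dis i1).
  pose k : I1 := SigSub (mem_set i1).
  rewrite !(@sub_vec_dfwith_in I1 x k) tensp_multilinear.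
  exact: tensp2_linearl.
rewrite !(sub_vec_dfwith_out (A := I1)); try by move=> /dis /(_ i2).
pose k : I2 := SigSub (mem_set i2).
rewrite !(@sub_vec_dfwith_in I2 x k) tensp_multilinear.
exact: tensp2_linearr.
Qed.

Lemma canonical_split_linear (I1 I2 : set I) :
  I1 `|` I2 = [set: I] -> I1 `&` I2 = set0 -> linear (canonical_split I1 I2).
Proof.
by move=> U12 D12; apply: tens_lift_linear; exact: canonical_split_multilinear.
Qed.

Lemma canonical_split_tensp (I1 I2 : set I) (x : forall i, H i) :
  I1 `|` I2 = [set: I] -> I1 `&` I2 = set0 ->
  canonical_split I1 I2 (tensp x) =
  tensp2 (tensp (sub_vec I1 x)) (tensp (sub_vec I2 x)).
Proof.
move=> U12 D12; exact: (tens_lift_tensp _ (canonical_split_multilinear U12 D12)).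
Qed.
End Partition.

Arguments canonical_split {C I H} I1 I2 t.

(* Main.v *)
(** For vectors u, v of norm at most 1, <u, v> = 1 forces u = v and |u| = 1.
    Hence for elementary tensors of vectors in the unit balls the phi1 form
    vanishes unless the two families agree, with norm 1, at almost all
    indices. A tensor of ball vectors with infinitely many entries of norm < 1 is
    therefore in the radical, while one with finitely many is a multiple of a
    tensor of unit vectors.

    On the span of the unit tensors the form is definite: finitely many unit
    families that are almost equal differ at finitely many indices only, and
    replacing the entries at these indices, one index at a time, by their
    expansions in a Gram-Schmidt basis writes every element as a combination of
    elementary tensors that are orthonormal for the phi1 form.

    For the splitting I = I1 + I2, gluing families gives the inverse of
    canonical_split. It is multiplicative for the phi1 forms, so the map from
    the tensor product of the two unit spaces to the unit space of I is
    isometric, and it is injective because the tensor product of two definite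
    forms is definite. *)

From HB Require Import structures.
Require Import Defs.
From mathcomp Require Import all_boot all_order all_algebra.
From mathcomp Require Import complex.
From mathcomp Require Import boolp classical_sets functions cardinality fsbigop.
From mathcomp Require Import reals.

Set Implicit Arguments.
Unset Strict Implicit.
Unset Printing Implicit Defensive.

Import Order.TTheory GRing.Theory Num.Theory.
Local Open Scope classical_set_scope.
Local Open Scope ring_scope.

(** * Hermitian forms and orthonormal families *)

(** Stated for bare functions, since the [phi1] forms are not given as library structures;
    semilinearity in the second variable follows from the two clauses. *)
Definition hermitian_form {C : numClosedFieldType} {V : lmodType C}
    (f : V -> V -> C) : Prop :=
  (forall y a u v, f (a *: u + v) y = a * f u y + f v y) /\
  (forall x y, f x y = (f y x)^*).

Section HermitianForms.
Context {C : numClosedFieldType} {V : lmodType C}.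
Implicit Type f : V -> V -> C.

Lemma hermitian_formP f : hermitian_form f ->
  exists g : {hermitian V for false & Num.conj}, f = g.
Proof.
move=> [fl fh].
have fr x a u v : f x (a *: u + v) = a^* * f x u + f x v.
  by rewrite fh fl rmorphD rmorphM /= [f x u]fh [f x v]fh.
have bil : bilinear_for (GRing.Scale.Law.clone _ _ ( *%R ) _)
    (GRing.Scale.Law.clone _ _ (Num.conj \; *%R) _) f.
  by split=> [y a u v|x a u v] /=; [exact: fl|exact: fr].
pose B := bilinear_isBilinear.Build C V V C _ _ f bil.
have herm x y : f x y = (-1) ^+ false * (f y x)^* by rewrite mul1r.
pose Hm := isHermitianSesquilinear.Build C V false Num.conj f herm.
pose g : {hermitian V for false & Num.conj} := HB.pack f B Hm.
  by exists g.
Qed.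

Lemma hermitian_form_dot (g : {dot V for Num.conj}) : hermitian_form g.
Proof.
split=> [y a u v|x y]; first by rewrite linearPl.
by rewrite hermC expr0 mul1r.
Qed.

Lemma is_inner_productP f : hermitian_form f ->
  (forall x, 0 <= f x x) -> (forall x, f x x = 0 -> x = 0) ->
  is_inner_product f.
Proof.
move=> /hermitian_formP[g ->] ge0 eq0.
have gt0 u : u != 0 -> 0 < g u u.
  by move=> u0; rewrite lt_def ge0 andbT; apply: contra_neq u0 => /eq0.
pose D := isDotProduct.Build C V g gt0.
pose d : {dot V for Num.conj} := HB.pack (g : V -> V -> C) g D.
by exists d.
Qed.

Definition orthonormal_seq f (es : seq V) : Prop :=
  uniq es /\ {in es &, forall u v, f u v = (u == v)%:R}.

Lemma orthonormal_sumE (g : {hermitian V for false & Num.conj}) es c d :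
  orthonormal_seq g es ->
  g (\sum_(e <- es) c e *: e) (\sum_(e <- es) d e *: e) =
  \sum_(e <- es) c e * (d e)^*.
Proof.
move=> [ues oes]; rewrite linear_sumlz big_seq [RHS]big_seq.
apply: eq_bigr => e ees; rewrite linearZl_LR linear_sumr /=; congr (_ * _).
rewrite (big_rem e)//= linearZr_LR/= oes// eqxx mulr1 big1_seq ?addr0//.
move=> e' /andP[_]; rewrite rem_filter// mem_filter => /andP[/= ne e'es].
by rewrite linearZr_LR/= oes// eq_sym (negPf ne) mulr0.
Qed.

Lemma orthonormal_norm (g : {hermitian V for false & Num.conj}) es c :
  orthonormal_seq g es ->
  let v := \sum_(e <- es) c e *: e in
  0 <= g v v /\ (g v v = 0 -> v = 0).
Proof.
move=> oes v; rewrite orthonormal_sumE//.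
have nn e : 0 <= c e * (c e)^* by rewrite mul_conjC_ge0.
split=> [|/eqP]; first exact: sumr_ge0.
rewrite psumr_eq0// => /allP c0; rewrite /v big1_seq// => e /andP[_ ees].
by have := c0 _ ees; rewrite /= mul_conjC_eq0 => /eqP ->; rewrite scale0r.
Qed.

(** Induction on [vs]: the part [w] of [v] orthogonal to the family found so far is normalised and
    adjoined, unless it vanishes. *)
Lemma gram_schmidt (f : {dot V for Num.conj}) (vs : seq V) :
  exists2 es, orthonormal_seq f es &
    {in vs, forall v, v = \sum_(e <- es) f v e *: e}.
Proof.
elim: vs => [|v vs [es [ues oes] vsE]]; first by exists [::].
pose w := v - \sum_(e <- es) f v e *: e.
have we : {in es, forall e, f w e = 0}.
  move=> e ees; rewrite linearBl linear_sumlz (big_rem e)//= linearZl_LR/= (oes e e)//.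
  rewrite eqxx mulr1 big1_seq ?addr0 ?subrr//.
  move=> e' /andP[_]; rewrite rem_filter// mem_filter => /andP[/= ne e'es].
  by rewrite linearZl_LR/= (oes e' e)// (negPf ne) mulr0.
have [w0|w0] := eqVneq w 0.
  exists es; first by split.
  move=> u; rewrite inE => /orP[/eqP ->|]; last exact: vsE.
  by apply/eqP; rewrite -subr_eq0 -/w w0.
pose n := sqrtC (f w w).
have n0 : n != 0 by rewrite sqrt_dnorm_eq0.
have nn : n^* = n by rewrite geC0_conj// sqrt_dnorm_ge0.
pose e0 := n^-1 *: w.
have e0e : {in es, forall e, f e0 e = 0}.
  by move=> e ees; rewrite linearZl_LR/= we ?mulr0.
have ee0 : {in es, forall e, f e e0 = 0}.
  by move=> e ees; rewrite (hermitian_form_dot f).2 e0e ?rmorph0.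
have fe0 : f e0 e0 = 1.
  rewrite linearZl_LR linearZr_LR/= fmorphV/= nn -[f w w]sqrtCK -/n expr2.
  by rewrite mulrA -invfM mulVf// mulf_neq0.
have e0es : e0 \notin es.
  by apply/negP => /e0e/eqP; rewrite fe0 oner_eq0.
exists (e0 :: es).
  split=> [|x y]; first by rewrite /= e0es.
  rewrite !inE => /orP[/eqP->|xes] /orP[/eqP->|yes]; rewrite ?eqxx ?fe0//.
  - by rewrite e0e//; case: eqP => // E; rewrite E yes in e0es.
  - by rewrite ee0//; case: eqP => // E; rewrite -E xes in e0es.
  - exact: oes.
move=> u; rewrite inE => /orP[/eqP->|uvs]; rewrite big_cons; last first.
  (* Vectors treated earlier lie in the span of [es] and have no component along [e0]. *)
  suff -> : f u e0 = 0 by rewrite scale0r add0r; exact: vsE.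
  rewrite (vsE _ uvs) linear_sumlz big1_seq// => e /andP[_ ees].
  by rewrite linearZl_LR/= ee0 ?mulr0.
have vE : v = w + \sum_(e <- es) f v e *: e by rewrite subrK.
(* [v] and [w] differ by a combination of [es], which is orthogonal to [e0]; so [f v e0] is
   [n ^ 2 / n]. *)
have -> : f v e0 = n.
  rewrite {1}vE linearDl linear_sumlz [X in _ + X]big1_seq ?addr0; last first.
    by move=> e /andP[_ ees]; rewrite linearZl_LR/= ee0 ?mulr0.
  by rewrite linearZr_LR/= fmorphV/= nn -[f w w]sqrtCK -/n expr2 mulKf.
by rewrite /e0 scalerA divff// scale1r -vE.
Qed.
End HermitianForms.

(** * Definiteness of the tensor product of two inner products *)

Lemma tens2_dot_definite {C : numClosedFieldType} {V W : lmodType C}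
    (f : {dot V for Num.conj}) (h : {dot W for Num.conj})
    (g : tens2 V W -> tens2 V W -> C) (s : tens2 V W) :
  hermitian_form g -> is_tensor2_form f h g ->
  0 <= g s s /\ (g s s = 0 -> s = 0).
Proof.
move=> /hermitian_formP[{}g ->] gE.
pose L0 w : {linear V -> tens2 V W} := HB.pack (fun v => tensp2 v w : tens2 V W)
  (GRing.isLinear.Build _ _ _ _ _ (tensp2_linearl w)).
pose P0 v : {linear W -> tens2 V W} := HB.pack (fun w => tensp2 v w : tens2 V W)
  (GRing.isLinear.Build _ _ _ _ _ (tensp2_linearr v)).
(* The existentials make [L] and [P] opaque, leaving only linearity and the values on pure
   tensors. *)
have [L LE] : exists L : W -> {linear V -> tens2 V W}, forall w v, L w v = tensp2 v w.
  by exists L0.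
have [P PE] : exists P : V -> {linear W -> tens2 V W}, forall v w, P v w = tensp2 v w.
  by exists P0.
(* Expanding the left factors in an orthonormal family, s is the sum of the
   e (x) w e, with squared norm the sum of those of the w e. *)
pose r : seq (C * forall b, pair_fam V W b) := repr s.
pose vt (p : C * forall b, pair_fam V W b) : V := p.2 true.
pose wt (p : C * forall b, pair_fam V W b) : W := p.2 false.
have [es [ues oes] esE] := gram_schmidt f [seq vt p | p <- r].
pose w e := \sum_(p <- r) (p.1 * f (vt p) e) *: wt p.
have sE : s = \sum_(e <- es) P e (w e).
  rewrite [LHS]tens_span -/r.
  under [RHS]eq_bigr do rewrite linear_sum.
  rewrite exchange_big /= big_seq [RHS]big_seq; apply: eq_bigr => p pr.
  transitivity (p.1 *: L (wt p) (vt p)).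
    by rewrite LE; congr (_ *: tensp _); apply: functional_extensionality_dep => -[].
  rewrite {1}(esE (vt p)) ?map_f//.
  rewrite linear_sum scaler_sumr; apply: eq_bigr => e _.
  by rewrite !linearZ /= LE PE scalerA mulrC.
have gss : g s s = \sum_(e <- es) h (w e) (w e).
  rewrite {1}sE linear_sumlz big_seq [RHS]big_seq; apply: eq_bigr => e ees.
  rewrite sE linear_sumr /= (big_rem e)//= !PE gE oes// eqxx mul1r.
  rewrite big1_seq ?addr0//.
  move=> e' /andP[_]; rewrite rem_filter// mem_filter => /andP[/= ne e'es].
  by rewrite !PE gE oes// eq_sym (negPf ne) mul0r.
rewrite gss; split=> [|/eqP]; first exact: sumr_ge0.
rewrite psumr_eq0 // => /allP h0; rewrite sE big1_seq// => e /andP[_ ees].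
by have := h0 _ ees; rewrite /= dnorm_eq0 => /eqP ->; rewrite linear0.
Qed.

(** * The phi1 form on elementary tensors *)

Section Phi1.
Context {C : numClosedFieldType} {I : choiceType}.
Implicit Type b : I -> C.

(** The list may contain indices where [b] is 1, so it need not be the exact exceptional set. *)
Lemma phi1_elem_prod b (s : seq I) : uniq s -> (forall i, i \notin s -> b i = 1) ->
  phi1_elem b = \prod_(i <- s) b i.
Proof.
move=> us bs; rewrite /phi1_elem asboolT; first by
  rewrite (@fsbigE _ _ _ _ setT s)//;
  [under eq_bigl do rewrite in_setT|move=> i _; exact: bs].
apply: (@sub_finite_set _ _ [set` s]); last exact: finite_seq.
by move=> i /= bi; apply: contrapT => /negP /bs.
Qed.

Lemma phi1_elem_infinite b : ~ finite_set [set i | b i <> 1] -> phi1_elem b = 0.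
Proof. by move=> nf; rewrite /phi1_elem asboolF. Qed.

Lemma phi1_elem_conj b : phi1_elem (fun i => (b i)^*) = (phi1_elem b)^*.
Proof.
have E : [set i | (b i)^* <> 1] = [set i | b i <> 1].
  apply/seteqP; split=> i /= bi E; apply: bi; first by rewrite E rmorph1.
  by rewrite -[b i]conjCK E rmorph1.
have [f|nf] := pselect (finite_set [set i | b i <> 1]); last first.
  by rewrite !phi1_elem_infinite ?E ?rmorph0.
have [s0 fE] := (finite_seqP _).1 f.
have out i : i \notin undup s0 -> b i = 1.
  rewrite mem_undup => /negP is0; apply: contrapT => bi; apply: is0.
  by have : [set i | b i <> 1] i := bi; rewrite fE.
rewrite !(phi1_elem_prod (undup_uniq s0)) ?rmorph_prod//.
by move=> i /out ->; rewrite rmorph1.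
Qed.

Lemma phi1_star (t : ctens C I) : phi1 (ctens_star t) = (phi1 t)^*.
Proof.
move: t; apply: (@tens_linear_ext _ _ _ (conjmod C^o)) => [a u v|a u v|b].
- by rewrite ctens_star_linear phi1_linear.
- by rewrite phi1_linear rmorphD rmorphM.
- by rewrite -[tensp b]/(ctensp b) ctens_star_tensp !phi1_ctensp phi1_elem_conj.
Qed.

Context {H : I -> lmodType C} (ip : forall i, {dot (H i) for Num.conj}).

Lemma phi1_form_hermitian : hermitian_form (phi1_form ip).
Proof.
split=> [y a u v|x y]; first by rewrite /phi1_form ctens_form_linearl phi1_linear.
by rewrite /phi1_form -phi1_star ctens_form_star.
Qed.

Lemma phi1_form_tensp x y :
  phi1_form ip (tensp x) (tensp y) = phi1_elem (fun i => ip i (x i) (y i)).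
Proof. by rewrite /phi1_form ctens_form_tensp phi1_ctensp. Qed.
End Phi1.

(** * Ball and unit families: vanishing and definiteness of the [phi1] form *)

Section UnitVectors.
Context {C : numClosedFieldType} {I : choiceType}.
Context {H : I -> lmodType C} (ip : forall i, {dot (H i) for Num.conj}).
Implicit Types x y : forall i, H i.

(** Equality case of Cauchy-Schwarz: the squared norm of [u - v] is at most 1 + 1 - 2 = 0. *)
Lemma dot_eq1 (V : lmodType C) (f : {dot V for Num.conj}) (u v : V) :
  f u u <= 1 -> f v v <= 1 -> f u v = 1 -> u = v.
Proof.
move=> u1 v1 uv; apply/eqP; rewrite -subr_eq0 -(dnorm_eq0 f).
rewrite eq_le dnorm_ge0 andbT dnormB uv rmorph1 subr_le0.
exact: lerD.
Qed.

Lemma ipnorm_eq1 i (u : H i) : (ipnorm ip u == 1) = (ip i u u == 1).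
Proof. by rewrite -[X in _ == X]sqrtC1 eqr_sqrtC. Qed.

Lemma ipnorm_le1 i (u : H i) : (ipnorm ip u <= 1) = (ip i u u <= 1).
Proof. by rewrite -[X in _ <= X]sqrtC1 ler_sqrtC ?qualifE/= ?dnorm_ge0. Qed.

Lemma unit_vecsP x : unit_vecs ip x <-> forall i, ip i (x i) (x i) = 1.
Proof. by split=> ux i; apply/eqP; [rewrite -ipnorm_eq1|rewrite ipnorm_eq1]; apply/eqP. Qed.

Lemma ball_vecsP x : ball_vecs ip x <-> forall i, ip i (x i) (x i) <= 1.
Proof. by split=> bx i; have := bx i; rewrite ipnorm_le1. Qed.

Lemma unit_ball x : unit_vecs ip x -> ball_vecs ip x.
Proof. by move=> ux i; rewrite ux. Qed.

(** By [dot_eq1] a factor [ip i (x i) (y i)] equals 1 only where the entries agree and have norm 1;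
    here infinitely many factors differ from 1. *)
Lemma phi1_form_ball0 x y : ball_vecs ip x -> ball_vecs ip y ->
  ~ finite_set [set i | ~ (x i = y i /\ ip i (x i) (x i) = 1)] ->
  phi1_form ip (tensp x) (tensp y) = 0.
Proof.
move=> /ball_vecsP bx /ball_vecsP yb nf.
rewrite phi1_form_tensp; apply: phi1_elem_infinite => f; apply: nf.
apply: sub_finite_set f => i /= nxy xy1; apply: nxy.
have xy := dot_eq1 (bx i) (yb i) xy1.
by split=> //; rewrite {2}xy.
Qed.

Lemma phi1_form_unit0 x y : unit_vecs ip x -> unit_vecs ip y ->
  ~ almost_eq x y -> phi1_form ip (tensp x) (tensp y) = 0.
Proof.
move=> ux uy nxy; apply: phi1_form_ball0; do ?exact: unit_ball.
by move=> f; apply: nxy; apply: sub_finite_set f => i /= xy [].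
Qed.

Lemma phi1_form_unit1 x : unit_vecs ip x -> phi1_form ip (tensp x) (tensp x) = 1.
Proof.
move=> /unit_vecsP ux; rewrite phi1_form_tensp (@phi1_elem_prod _ _ _ [::])//.
by rewrite big_nil.
Qed.

(** Almost equality of [x] and [y] turns the form into a finite product, which one zero factor
    annihilates. *)
Lemma phi1_form_orth x y i : almost_eq x y -> unit_vecs ip x ->
  ip i (x i) (y i) = 0 -> phi1_form ip (tensp x) (tensp y) = 0.
Proof.
move=> /finite_seqP[s xyE] /unit_vecsP ux xy0.
rewrite phi1_form_tensp (phi1_elem_prod (undup_uniq (i :: s))).
  rewrite (big_rem i) ?mem_undup ?mem_head//= xy0 mul0r //.
move=> j; rewrite mem_undup inE negb_or => /andP[_ /negP js].
have <- : x j = y j; last exact: ux.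
by apply: contrapT => xyj; apply: js; have : [set i | x i <> y i] j by []; rewrite xyE.
Qed.

(** One coordinate varies and the others are frozen; the existential keeps the map opaque in later
    rewriting. *)
Lemma tensp_dfwith_lin x i :
  exists L : {linear H i -> tens H}, forall u, L u = tensp (dfwith x u).
Proof.
pose L : {linear H i -> tens H} := HB.pack (fun u => tensp (dfwith x u))
  (GRing.isLinear.Build _ _ _ _ _ (tensp_multilinear x (i := i))).
by exists L.
Qed.

Lemma dfwith_id x i : dfwith x (x i) = x.
Proof. by apply: functional_extensionality_dep => j; case: dfwithP. Qed.

(* r lists the coordinates not yet treated: the induction replaces the entries
   at one of them by their expansions in an orthonormal family of H i. *)
Lemma orthogonalize_coordinates (r : seq I) (T : finType) (a : T -> C)
    (x : T -> forall i, H i) : (forall k, unit_vecs ip (x k)) ->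
  (forall k l, almost_eq (x k) (x l) -> forall i, i \notin r ->
     x k i = x l i \/ ip i (x k i) (x l i) = 0) ->
  exists (T' : finType) (a' : T' -> C) (x' : T' -> forall i, H i),
    [/\ forall k, unit_vecs ip (x' k),
        forall k l, almost_eq (x' k) (x' l) -> forall i,
          x' k i = x' l i \/ ip i (x' k i) (x' l i) = 0
      & \sum_k a k *: tensp (x k) = \sum_k a' k *: tensp (x' k)].
Proof.
elim: r T a x => [|i r IH] T a x ux ox.
  by exists T, a, x; split=> // k l kl i; exact: ox.
have [es [ues oes] esE] := gram_schmidt (ip i) [seq x k i | k : T].
pose e (j : 'I_(size es)) : H i := es`_j.
have ees j : e j \in es by exact: mem_nth.
(* Each term splits into one term per vector of [es], weighted by the Fourier coefficient of its
   entry at [i]. *)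
pose T' : finType := (T * 'I_(size es))%type.
pose a' (p : T') := a p.1 * ip i (x p.1 i) (e p.2).
pose x' (p : T') := dfwith (x p.1) (e p.2).
have out p j : i != j -> x' p j = x p.1 j by exact: dfwith_out.
have -> : \sum_k a k *: tensp (x k) = \sum_p a' p *: tensp (x' p).
  rewrite -(pair_bigA _ (fun k j => a' (k, j) *: tensp (x' (k, j)))) /=.
  apply: eq_bigr => k _; have [L LE] := tensp_dfwith_lin (x k) i.
  rewrite -{1}(dfwith_id (x k) i) -LE {1}(esE (x k i)); last exact: (codom_f (fun k => x k i)).
  rewrite (big_nth 0) big_mkord linear_sum scaler_sumr.
  by apply: eq_bigr => j _; rewrite linearZ /= LE scalerA.
apply: IH => [p|p q pq j jr].
  apply/unit_vecsP => j; have [<-|ij] := eqVneq i j.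
    by rewrite /x' dfwith_in oes// eqxx.
  by rewrite out//; exact: (unit_vecsP _).1.
have [<-|ij] := eqVneq i j.
  rewrite /x' !dfwith_in oes//; case: eqP => [->|_]; [by left|by right].
(* Away from [i] the entries are the old ones. Almost equality passes from the new families to the
   old ones, which can differ in addition only at [i]. *)
rewrite !out//; apply: ox; last by rewrite inE negb_or eq_sym ij.
apply: (@sub_finite_set _ _ ([set i] `|` [set j | x' p j <> x' q j])).
  move=> l /= xl; have [<-|il] := eqVneq i l; first by left.
  by right; rewrite !out.
by rewrite finite_setU; split=> //; exact: finite_set1.
Qed.

(** Orthogonalisation may produce the same tensor several times; collecting coefficients gives the
    duplicate-free list that [orthonormal_seq] demands. *)
Lemma sum_undup (T : finType) (V : lmodType C) (a : T -> C) (v : T -> V) :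
  \sum_k a k *: v k =
  \sum_(e <- undup [seq v k | k : T]) (\sum_(k | v k == e) a k) *: e.
Proof.
under [RHS]eq_bigr do rewrite scaler_suml.
rewrite (exchange_big_dep xpredT)//=; apply: eq_bigr => k _.
rewrite big_mkcond/= (big_rem (v k)) ?mem_undup ?(codom_f v)//= eqxx.
rewrite big1_seq ?addr0// => e /andP[_].
rewrite rem_filter ?undup_uniq// mem_filter => /andP[/= ne _].
by rewrite eq_sym (negPf ne).
Qed.

(** After orthogonalisation, two distinct tensors come either from families that are not almost
    equal or from families with an orthogonal pair of entries; the form vanishes in both cases. *)
Lemma unit_span_orthonormal (xi : tens H) :
  xi \in Defs.span (@tensp C I H @` unit_vecs ip) ->
  exists2 es, orthonormal_seq (phi1_form ip) es &
    exists c, xi = \sum_(e <- es) c e *: e.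
Proof.
move=> /spanP[n [a [v [vu ->]]]].
have /choice[x xP] : forall k, exists x, unit_vecs ip x /\ tensp x = v k.
  by move=> k; have [x ux xv] := vu k; exists x.
(* One finite list must serve all pairs of the sum: the difference sets of the almost equal pairs
   are concatenated. *)
have [r rP] : exists r : seq I, forall k l, almost_eq (x k) (x l) ->
    forall i, i \notin r -> x k i = x l i.
  have /choice[R RP] : forall kl : 'I_n * 'I_n, exists r : seq I,
      almost_eq (x kl.1) (x kl.2) -> forall i, i \notin r -> x kl.1 i = x kl.2 i.
    move=> [k l] /=; have [kl|nkl] := pselect (almost_eq (x k) (x l)); last first.
      by exists [::] => /nkl.
    have /finite_seqP[r rE] := kl; exists r => _ i /negP ir.
    apply: contrapT => xi'; apply: ir.
    by have : [set i | x k i <> x l i] i by []; rewrite rE.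
  exists (flatten [seq R kl | kl : 'I_n * 'I_n]) => k l kl i ir.
  apply: (RP (k, l)) => //; apply: contra ir => ir; apply/flattenP.
  by exists (R (k, l)) => //; exact: codom_f.
have [|k l kl i ir|T [a' [x' [ux' ox' xiE]]]] :=
    @orthogonalize_coordinates r 'I_n a x.
- by move=> k; case: (xP k).
- by left; exact: rP kl _ ir.
under eq_bigr do rewrite -(xP _).2.
rewrite xiE sum_undup; eexists; last by eexists; reflexivity.
split=> [|u w]; first exact: undup_uniq.
rewrite !mem_undup => /codomP[k ->] /codomP[l ->].
have [<-|ne] := eqVneq; first by rewrite phi1_form_unit1.
have [kl|nkl] := pselect (almost_eq (x' k) (x' l)); last exact: phi1_form_unit0.
have [[i xi0]|xi0] := pselect (exists i, ip i (x' k i) (x' l i) = 0).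
  exact: phi1_form_orth xi0.
(* Without an orthogonal coordinate all entries agree, so the two tensors are equal. *)
case/negP: ne; apply/eqP; congr tensp; apply: functional_extensionality_dep => i.
by case: (ox' _ _ kl i) => // ?; case: xi0; exists i.
Qed.

Lemma phi1_form_un (xi : tens H) :
  xi \in Defs.span (@tensp C I H @` unit_vecs ip) ->
  0 <= phi1_form ip xi xi /\ (phi1_form ip xi xi = 0 -> xi = 0).
Proof.
move=> /unit_span_orthonormal[es oes [c ->]].
have [g gE] := hermitian_formP (phi1_form_hermitian ip).
by rewrite gE in oes *; exact: orthonormal_norm.
Qed.
End UnitVectors.

(** * Spans of elementary tensors *)

Section Spans.
Context {K : nzRingType} {V : lmodType K}.
Implicit Type A : set V.

Lemma span_valP A : linear (@span_val K V A).
Proof. exact: (linearP (\val : span_space A -> V)). Qed.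

Lemma span_val_inj A : injective (@span_val K V A).
Proof. exact: val_inj. Qed.

Lemma span_val_in A (u : span_space A) : span_val u \in Defs.span A.
Proof. exact: valP. Qed.

Lemma span_val_sum A (T : finType) (a : T -> K) (u : T -> span_space A) :
  span_val (\sum_k a k *: u k) = \sum_k a k *: span_val (u k).
Proof.
rewrite -[LHS]/(\val _) raddf_sum; apply: eq_bigr => k _.
exact: (linearZ_LR (\val : span_space A -> V)).
Qed.

Lemma span_sub A (S : submodClosed V) (v : V) :
  (forall u, A u -> u \in S) -> v \in Defs.span A -> v \in S.
Proof.
move=> AS /spanP[n [a [x [Ax ->]]]].
by apply: rpred_sum => k _; rewrite rpredZ ?AS.
Qed.

Lemma span_spaceP A (xi : span_space A) :
  exists n (a : 'I_n -> K) (u : 'I_n -> span_space A),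
    (forall k, A (span_val (u k))) /\ xi = \sum_k a k *: u k.
Proof.
have /spanP[n [a [x [Ax xE]]]] := span_val_in xi.
exists n, a, (fun k => SpanSpace (mem_span (Ax k))); split=> //.
by apply: span_val_inj; rewrite span_val_sum xE.
Qed.
End Spans.

Lemma span_space_form_ext {C : numClosedFieldType} {V : lmodType C} (A : set V)
    (f g : span_space A -> span_space A -> C) :
  hermitian_form f -> hermitian_form g ->
  (forall u v, A (span_val u) -> A (span_val v) -> f u v = g u v) ->
  forall u v, f u v = g u v.
Proof.
move=> /hermitian_formP[{}f ->] /hermitian_formP[{}g ->] fg u v.
have [n [a [x [Ax ->]]]] := span_spaceP u.
have [m [b [y [Ay ->]]]] := span_spaceP v.
rewrite !linear_sumlz; apply: eq_bigr => k _; rewrite !linear_sumr /=.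
by apply: eq_bigr => l _; rewrite !(linearZl_LR, linearZr_LR)/= fg.
Qed.

Lemma hermitian_form_span {C : numClosedFieldType} {V : lmodType C} (A : set V)
    (f : V -> V -> C) : hermitian_form f ->
  hermitian_form (fun u v : span_space A => f (span_val u) (span_val v)).
Proof. by move=> [fl fh]; split=> [y a u v|x y]; rewrite ?span_valP ?fl// fh. Qed.

(** * The ball span as the radical plus the unit span *)

Section Decomposition.
Context {C : numClosedFieldType} {I : choiceType}.
Context {H : I -> lmodType C} (ip : forall i, {dot (H i) for Num.conj}).
Implicit Types x y : forall i, H i.

(** Stated for any generators inside the unit span, so that it covers each [tens_mu], [tens_un] and
    the unit spaces of [I1] and [I2]. *)
Lemma phi1_form_inner_product (A : set (tens H)) :
  (forall t, A t -> t \in Defs.span (@tensp C I H @` unit_vecs ip)) ->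
  is_inner_product
    (fun u v : span_space A => phi1_form ip (span_val u) (span_val v)).
Proof.
move=> Aun; have un (u : span_space A) := span_sub Aun (span_val_in u).
apply: is_inner_productP => [|u|u u0].
- exact: hermitian_form_span (phi1_form_hermitian ip).
- by case: (phi1_form_un (un u)).
- by apply: span_val_inj; case: (phi1_form_un (un u)) => _ ->.
Qed.

(** Off a finite set [x] and [y] both agree with the unit family [u0], so [phi1_elem] takes its
    product branch. *)
Lemma phi1_form_prod_mu (mu : set (forall i, H i)) x y : Omega_un ip mu ->
  prod_mu mu x -> prod_mu mu y ->
  phi1_form ip (tensp x) (tensp y) =
  \big[*%R/1]_(i \in [set: I]) ip i (x i) (y i).
Proof.
move=> [u0 /unit_vecsP u01 ->] [u [_ uu0] xu] [v [_ vu0] yv].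
rewrite phi1_form_tensp /phi1_elem asboolT//.
apply: sub_finite_set (_ : finite_set
  (([set i | u i <> u0 i] `|` [set i | x i <> u i]) `|`
   ([set i | v i <> u0 i] `|` [set i | y i <> v i]))); last by rewrite !finite_setU.
move=> i /= xy; apply: contrapT => /not_orP[/not_orP[/contrapT ui /contrapT xi]].
by move=> /not_orP[/contrapT vi /contrapT yi]; apply: xy; rewrite xi yi ui vi.
Qed.

Context (nonzero_H : forall i, exists u : H i, u != 0).

Lemma scaled_unit i (v : H i) : exists a u, ip i u u = 1 /\ v = a *: u.
Proof.
have nz (w : H i) : w != 0 -> exists a u, ip i u u = 1 /\ w = a *: u.
  move=> w0; pose n := sqrtC (ip i w w).
  have n0 : n != 0 by rewrite sqrt_dnorm_eq0.
  exists n, (n^-1 *: w); split; last by rewrite scalerA divff// scale1r.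
  rewrite dnormZ normfV exprVn ger0_norm ?sqrt_dnorm_ge0// sqrtCK mulVf//.
  by rewrite dnorm_eq0.
(* The zero vector is 0 times a unit vector, which exists because [H i] is non-zero. *)
have [v0|/nz//] := eqVneq v 0.
have [w /nz[a [u [u1 _]]]] := nonzero_H i.
by exists 0, u; rewrite scale0r.
Qed.

(** The exceptional indices are normalised one at a time, and multilinearity pulls each scalar
    out. *)
Lemma tensp_scaled_unit x : finite_set [set i | ip i (x i) (x i) <> 1] ->
  exists c y, unit_vecs ip y /\ tensp x = c *: tensp y.
Proof.
move=> /finite_seqP[s sE].
(* Only the inclusion of the exceptional set in [s] is kept; equality need not survive the
   induction. *)
have : forall i, i \notin s -> ip i (x i) (x i) = 1.
  move=> i /negP is_; apply: contrapT => xi; apply: is_.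
  by have : [set i | ip i (x i) (x i) <> 1] i by []; rewrite sE.
elim: s x {sE} => [|i s IH] x x1.
  by exists 1, x; split; [apply/unit_vecsP => i; exact: x1|rewrite scale1r].
have [a [u [u1 xu]]] := scaled_unit (x i).
have [j js|c [y [y1 yE]]] := IH (dfwith x u).
  have [<-|ij] := eqVneq i j; first by rewrite dfwith_in.
  by rewrite dfwith_out// x1// inE negb_or eq_sym ij.
exists (a * c), y; split=> //; rewrite -scalerA -yE.
have [L LE] := tensp_dfwith_lin x i.
by rewrite -{1}(dfwith_id x i) -!LE xu linearZ.
Qed.

(** This puts every [tens_mu] inside [tens_un], so that definiteness in (a) comes from the unit
    span. *)
Lemma prod_mu_un (mu : set (forall i, H i)) x : Omega_un ip mu -> prod_mu mu x ->
  tensp x \in Defs.span (@tensp C I H @` unit_vecs ip).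
Proof.
move=> [u0 /unit_vecsP u01 ->] [u [/unit_vecsP u1 _] xu].
have [|c [y [uy ->]]] := @tensp_scaled_unit x.
  by apply: sub_finite_set xu => i /= xi E; apply: xi; rewrite E.
by rewrite rpredZ// mem_span//; exists y.
Qed.

Lemma un_ct t : t \in Defs.span (@tensp C I H @` unit_vecs ip) ->
  t \in Defs.span (@tensp C I H @` ball_vecs ip).
Proof.
apply: span_sub => _ [x ux <-]; apply: mem_span.
by exists x => //; exact: unit_ball.
Qed.

(** Existence half of the direct sum, chosen term by term: a ball tensor is either a multiple of a
    unit tensor, and kept, or orthogonal to all ball tensors, and dropped. *)
Lemma ct_decomposition t : t \in Defs.span (@tensp C I H @` ball_vecs ip) ->
  exists2 u, u \in Defs.span (@tensp C I H @` unit_vecs ip) &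
    forall w, w \in Defs.span (@tensp C I H @` ball_vecs ip) ->
      phi1_form ip w (t - u) = 0.
Proof.
have [g gE] := hermitian_formP (phi1_form_hermitian ip).
move=> /spanP[n [a [v [vb ->]]]].
have /choice[u uP] : forall k, exists u,
    u \in Defs.span (@tensp C I H @` unit_vecs ip) /\
    forall w, w \in Defs.span (@tensp C I H @` ball_vecs ip) ->
      phi1_form ip w (v k - u) = 0.
  move=> k; have [x bx <-] := vb k.
  have [/tensp_scaled_unit[c [y [uy ->]]]|nf] :=
      pselect (finite_set [set i | ip i (x i) (x i) <> 1]).
    exists (c *: tensp y); split; first by rewrite rpredZ// mem_span//; exists y.
    by move=> w _; rewrite subrr gE linear0r.
  exists 0; split=> [|_ /spanP[m [b [z [zb ->]]]]]; first exact: rpred0.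
  rewrite subr0 gE linear_sumlz big1// => l _; rewrite linearZl_LR/= -gE.
  have [y yb <-] := zb l; rewrite phi1_form_ball0 ?mulr0// => f; apply: nf.
  by apply: sub_finite_set f => i /= xi [yx yi]; apply: xi; rewrite -yx.
exists (\sum_k a k *: u k).
  by apply: rpred_sum => k _; rewrite rpredZ//; case: (uP k).
move=> w wb; rewrite -sumrB gE linear_sumr big1//= => k _.
by rewrite -scalerBr linearZr_LR/= -gE (uP k).2 ?mulr0.
Qed.
End Decomposition.

(** * Splitting the index set *)

Lemma tens2_linear_ext {C : numClosedFieldType} {V W X : lmodType C}
    (f g : tens2 V W -> X) : linear f -> linear g ->
  (forall v w, f (tensp2 v w) = g (tensp2 v w)) -> f =1 g.
Proof.
move=> lf lg fg; apply: tens_linear_ext => // z.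
have -> : z = pair_vec (z true) (z false); last exact: fg.
by apply: functional_extensionality_dep => -[].
Qed.

Section Glue.
Context {C : numClosedFieldType} {I : choiceType} {H : I -> lmodType C}.
Context {I1 I2 : set I} (U12 : I1 `|` I2 = [set: I]) (D12 : I1 `&` I2 = set0).

Lemma cover_compl i : ~ I1 i -> I2 i.
Proof. by move=> n1; have : [set: I] i by []; rewrite -U12 => -[]. Qed.

Lemma cover_disj i : I1 i -> ~ I2 i.
Proof. by move=> i1 i2; have : (I1 `&` I2) i by []; rewrite D12. Qed.

(** The value of each [SigSub] is [i] by computation, so both branches have type [H i] without a
    cast. *)
Definition glue_vec (x : forall i, sub_fam H I1 i) (y : forall i, sub_fam H I2 i)
    : forall i, H i :=
  fun i => match pselect (I1 i) with
    | left i1 => x (SigSub (mem_set i1))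
    | right n1 => y (SigSub (mem_set (cover_compl n1)))
    end.

Lemma sub_vec_glue_vec1 x y : sub_vec I1 (glue_vec x y) = x.
Proof.
apply: functional_extensionality_dep => -[i i1]; rewrite /sub_vec /glue_vec /=.
case: pselect => [p|/(_ (set_mem i1))//].
by rewrite (bool_irrelevance (mem_set p) i1).
Qed.

Lemma sub_vec_glue_vec2 x y : sub_vec I2 (glue_vec x y) = y.
Proof.
apply: functional_extensionality_dep => -[i i2]; rewrite /sub_vec /glue_vec /=.
case: pselect => [p|p]; first by have := cover_disj p (set_mem i2).
by rewrite (bool_irrelevance (mem_set _) i2).
Qed.

Lemma glue_vec_sub_vec z : glue_vec (sub_vec I1 z) (sub_vec I2 z) = z.
Proof.
by apply: functional_extensionality_dep => i; rewrite /glue_vec; case: pselect.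
Qed.

(** Comparing restrictions to [I1] and [I2] avoids a case analysis on dependent indices. *)
Lemma glue_vec_dfwith1 x y (i : I1) (u : sub_fam H I1 i) :
  glue_vec (dfwith x u) y = dfwith (glue_vec x y) (u : H (val i)).
Proof.
rewrite -[RHS]glue_vec_sub_vec sub_vec_dfwith_in sub_vec_glue_vec1.
by rewrite sub_vec_dfwith_out ?sub_vec_glue_vec2//; apply: cover_disj; exact: set_valP.
Qed.

Lemma glue_vec_dfwith2 x y (i : I2) (u : sub_fam H I2 i) :
  glue_vec x (dfwith y u) = dfwith (glue_vec x y) (u : H (val i)).
Proof.
rewrite -[RHS]glue_vec_sub_vec sub_vec_dfwith_in sub_vec_glue_vec2.
rewrite sub_vec_dfwith_out ?sub_vec_glue_vec1// => /cover_disj; apply.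
exact: set_valP.
Qed.

Definition tens_merge (t : tens (sub_fam H I1)) (s : tens (sub_fam H I2)) : tens H :=
  tens_lift (fun x => tens_lift (fun y => tensp (glue_vec x y)) s) t.

Lemma tens_merge_inner x : multilinear (fun y => tensp (glue_vec x y)).
Proof. by move=> y i a u v; rewrite !glue_vec_dfwith2 tensp_multilinear. Qed.

Lemma tens_merge_outer s :
  multilinear (fun x => tens_lift (fun y => tensp (glue_vec x y)) s).
Proof.
apply: (@multilinear_sum _ _ _ _ _ _ (fun p => p.1)
  (fun p x => tensp (glue_vec x p.2))) => p x i a u v.
by rewrite !glue_vec_dfwith1 tensp_multilinear.
Qed.

Lemma tens_merge_linearl s : linear (tens_merge^~ s).
Proof. exact: tens_lift_linear (tens_merge_outer s). Qed.

Lemma tens_merge_tensp x y : tens_merge (tensp x) (tensp y) = tensp (glue_vec x y).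
Proof.
rewrite /tens_merge tens_lift_tensp; last exact: tens_merge_outer.
by rewrite tens_lift_tensp//; exact: tens_merge_inner.
Qed.

(** The second argument sits under the outer lift, so the claim is first reduced to elementary
    [t]. *)
Lemma tens_merge_linearr t : linear (tens_merge t).
Proof.
move=> a s s'; move: t; apply: tens_linear_ext; first exact: tens_merge_linearl.
  move=> c u v; rewrite !tens_merge_linearl !scalerDr !scalerA [a * c]mulrC.
  by rewrite addrACA.
move=> x; rewrite /tens_merge !tens_lift_tensp; try exact: tens_merge_outer.
exact: (tens_lift_linear (tens_merge_inner x)).
Qed.

Definition tens_merge2 (z : tens2 (tens (sub_fam H I1)) (tens (sub_fam H I2))) : tens H :=
  tens_lift (fun p => tens_merge (p true) (p false)) z.

Lemma tens_merge2_multilinear :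
  multilinear (fun p : forall b, pair_fam (tens (sub_fam H I1)) (tens (sub_fam H I2)) b =>
    tens_merge (p true) (p false)).
Proof.
move=> p [] a u v; rewrite !dfwith_in !dfwith_out//.
  exact: tens_merge_linearl.
exact: tens_merge_linearr.
Qed.

Lemma tens_merge2_linear : linear tens_merge2.
Proof. exact: tens_lift_linear tens_merge2_multilinear. Qed.

Lemma tens_merge2_tensp2 t s : tens_merge2 (tensp2 t s) = tens_merge t s.
Proof. exact: tens_lift_tensp tens_merge2_multilinear. Qed.

Lemma canonical_splitK : cancel (canonical_split I1 I2) tens_merge2.
Proof.
apply: tens_linear_ext => [a u v|a u v|x].
- by rewrite canonical_split_linear// tens_merge2_linear.
- by [].
- by rewrite canonical_split_tensp// tens_merge2_tensp2 tens_merge_tensp glue_vec_sub_vec.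
Qed.

Lemma tens_merge2K : cancel tens_merge2 (canonical_split I1 I2).
Proof.
have lc := @canonical_split_linear _ _ H _ _ U12 D12.
apply: tens2_linear_ext => [a u v|//|t s].
  by rewrite tens_merge2_linear lc.
rewrite tens_merge2_tensp2; move: t; apply: tens_linear_ext => [a u v|a u v|x].
- by rewrite tens_merge_linearl lc.
- by rewrite tensp2_linearl.
move: s; apply: tens_linear_ext => [a u v|a u v|y].
- by rewrite tens_merge_linearr lc.
- by rewrite tensp2_linearr.
by rewrite tens_merge_tensp canonical_split_tensp// sub_vec_glue_vec1 sub_vec_glue_vec2.
Qed.

Lemma big_sub_seq (A : set I) (b : I -> C) (s : seq I) :
  \prod_(i <- s | i \in A) b i =
  \prod_(i <- (pmap insub s : seq A)) b (val i).
Proof.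
rewrite -big_filter -(big_map val xpredT b) pmap_filter; last exact: insubK.
by congr bigop; apply: eq_filter => i; rewrite isSome_insub.
Qed.

(** The exceptional set of [b] is finite exactly when both its parts are. If it is infinite, a
    factor on the right vanishes; otherwise one finite product is split by membership in [I1]. *)
Lemma phi1_elem_split (b : I -> C) :
  phi1_elem b =
  phi1_elem (fun i : I1 => b (val i)) * phi1_elem (fun i : I2 => b (val i)).
Proof.
have finV (A : set I) : finite_set [set i : A | b (val i) <> 1] ->
    finite_set [set i | A i /\ b i <> 1].
  move=> /(finite_image val); apply: sub_finite_set => i /= [Ai bi].
  by exists (SigSub (mem_set Ai)).
have [f|nf] := pselect (finite_set [set i | b i <> 1]); last first.
  rewrite [LHS]phi1_elem_infinite//.
  have [f1|nf1] := pselect (finite_set [set i : I1 | b (val i) <> 1]); last first.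
    by rewrite [X in X * _]phi1_elem_infinite// mul0r.
  rewrite [X in _ * X]phi1_elem_infinite ?mulr0// => f2; apply: nf.
  apply: (@sub_finite_set _ _
    ([set i | I1 i /\ b i <> 1] `|` [set i | I2 i /\ b i <> 1])).
    move=> i /= bi; have : [set: I] i by [].
    by rewrite -U12 => -[]; [left|right].
  by rewrite finite_setU; split; exact: finV.
have [s0 sE] := (finite_seqP _).1 f; pose s := undup s0.
have out i : i \notin s -> b i = 1.
  rewrite mem_undup => /negP is0; apply: contrapT => bi; apply: is0.
  by have : [set i | b i <> 1] i := bi; rewrite sE.
have sub (A : set I) : phi1_elem (fun i : A => b (val i)) = \prod_(i <- s | i \in A) b i.
  rewrite big_sub_seq; apply: phi1_elem_prod.
    by apply: pmap_sub_uniq; exact: undup_uniq.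
  by move=> i; rewrite mem_pmap_sub => /out.
rewrite !sub (phi1_elem_prod (undup_uniq s0))// -/s (bigID (mem I1))/=.
congr (_ * _); apply: eq_bigl => i; apply/idP/idP.
  by move=> /negP n1; apply/mem_set/cover_compl => i1; apply/n1/mem_set.
by move=> /set_mem i2; apply/negP => /set_mem /cover_disj.
Qed.

Context (ip : forall i, {dot (H i) for Num.conj}).

Lemma phi1_form_tens_merge t s t' s' :
  phi1_form ip (tens_merge t s) (tens_merge t' s') =
  phi1_form (sub_ip ip I1) t t' * phi1_form (sub_ip ip I2) s s'.
Proof.
have [l h] := phi1_form_hermitian ip.
have [l1 h1] := phi1_form_hermitian (sub_ip ip I1).
have [l2 h2] := phi1_form_hermitian (sub_ip ip I2).
(* [step] uses linearity in the first variables only; it is applied twice, with conjugate symmetry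
   exchanging the two sides in between. *)
have step x' y' u w : (forall x y,
      phi1_form ip (tens_merge (tensp x) (tensp y)) (tens_merge x' y') =
      phi1_form (sub_ip ip I1) (tensp x) x' * phi1_form (sub_ip ip I2) (tensp y) y') ->
    phi1_form ip (tens_merge u w) (tens_merge x' y') =
    phi1_form (sub_ip ip I1) u x' * phi1_form (sub_ip ip I2) w y'.
  move=> E; move: u; apply: (@tens_linear_ext _ _ _ C^o) => [a u v|a u v|x].
  - by rewrite tens_merge_linearl l.
  - by rewrite l1 mulrDl -mulrA.
  move: w; apply: (@tens_linear_ext _ _ _ C^o) => [a u v|a u v|y].
  - by rewrite tens_merge_linearr l.
  - by rewrite l2 mulrDr mulrCA.
  exact: E.
apply: (step) => x y; rewrite h h1 h2 -rmorphM; congr (_^*).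
apply: step => x' y'; rewrite !tens_merge_tensp !phi1_form_tensp phi1_elem_split.
congr (_ * _); congr phi1_elem; apply: funext => i.
  by rewrite -[x' in RHS](sub_vec_glue_vec1 x' y') -[x in RHS](sub_vec_glue_vec1 x y).
by rewrite -[y' in RHS](sub_vec_glue_vec2 x' y') -[y in RHS](sub_vec_glue_vec2 x y).
Qed.
End Glue.

(** * The isometric splitting of the unit tensor space *)

Section UnitTensorSplit.
Context {C : numClosedFieldType} {I : choiceType} {H : I -> lmodType C}.
Context (ip : forall i, {dot (H i) for Num.conj}) {I1 I2 : set I}.
Context (U12 : I1 `|` I2 = [set: I]) (D12 : I1 `&` I2 = set0).

Let un1 := tens_un (sub_ip ip I1).
Let un2 := tens_un (sub_ip ip I2).
Let emb : tens2 un1 un2 -> tens2 (tens (sub_fam H I1)) (tens (sub_fam H I2)) :=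
  tens2_map (fun a : un1 => span_val a) (fun b : un2 => span_val b).
(** The candidate inverse of the splitting, with values in all of [tens H]; [join_un] and
    [join_surj] show that its image is the unit span. *)
Let join (s : tens2 un1 un2) : tens H := tens_merge2 U12 (emb s).

Let emb_linear : linear emb.
Proof.
exact: (tens2_map_linear (\val : {linear un1 -> tens (sub_fam H I1)})
  (\val : {linear un2 -> tens (sub_fam H I2)})).
Qed.

Let emb_tensp2 a b : emb (tensp2 a b) = tensp2 (span_val a) (span_val b).
Proof.
exact: (tens2_map_tensp2 (\val : {linear un1 -> tens (sub_fam H I1)})
  (\val : {linear un2 -> tens (sub_fam H I2)})).
Qed.

Let join_linear : linear join.
Proof. by move=> a u v; rewrite /join emb_linear tens_merge2_linear. Qed.

Let join_tensp2 a b : join (tensp2 a b) = tens_merge U12 (span_val a) (span_val b).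
Proof. by rewrite /join emb_tensp2 tens_merge2_tensp2. Qed.

Lemma sub_vec_unit (A : set I) (x : forall i, H i) :
  unit_vecs ip x -> unit_vecs (sub_ip ip A) (sub_vec A x).
Proof. by move=> ux i; exact: ux. Qed.

Lemma glue_vec_unit x y : unit_vecs (sub_ip ip I1) x -> unit_vecs (sub_ip ip I2) y ->
  unit_vecs ip (glue_vec U12 x y).
Proof. by move=> ux uy i; rewrite /glue_vec; case: pselect => p; [exact: ux|exact: uy]. Qed.

Lemma tens_merge_un t s :
  t \in Defs.span (@tensp C I1 (sub_fam H I1) @` unit_vecs (sub_ip ip I1)) ->
  s \in Defs.span (@tensp C I2 (sub_fam H I2) @` unit_vecs (sub_ip ip I2)) ->
  tens_merge U12 t s \in Defs.span (@tensp C I H @` unit_vecs ip).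
Proof.
move=> /spanP[n [a [u [uu ->]]]] /spanP[m [b [w [wu ->]]]].
pose L s : {linear tens (sub_fam H I1) -> tens H} := HB.pack (fun t => tens_merge U12 t s)
  (GRing.isLinear.Build _ _ _ _ _ (tens_merge_linearl U12 D12 s)).
pose R t : {linear tens (sub_fam H I2) -> tens H} := HB.pack (tens_merge U12 t)
  (GRing.isLinear.Build _ _ _ _ _ (tens_merge_linearr U12 D12 t)).
rewrite -[tens_merge _ _ _]/(L _ _) linear_sum; apply: rpred_sum => k _.
rewrite linearZ rpredZ//= -[tens_merge _ _ _]/(R _ _) linear_sum; apply: rpred_sum => l _.
rewrite linearZ rpredZ//=; have [x ux <-] := uu k; have [y uy <-] := wu l.
rewrite tens_merge_tensp//; apply: mem_span.
by exists (glue_vec U12 x y) => //; exact: glue_vec_unit.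
Qed.

Let join_un s : join s \in Defs.span (@tensp C I H @` unit_vecs ip).
Proof.
pose J : {linear tens2 un1 un2 -> tens H} := HB.pack join
  (GRing.isLinear.Build _ _ _ _ _ join_linear).
rewrite [s]tens_span -[join _]/(J _) linear_sum; apply: rpred_sum => p _.
rewrite linearZ rpredZ//=.
have -> : tensp p.2 = tensp2 (p.2 true : un1) (p.2 false : un2).
  by congr tensp; apply: functional_extensionality_dep => -[].
by rewrite join_tensp2; apply: tens_merge_un; exact: span_val_in.
Qed.

Let join_surj (xi : tens_un ip) : exists s, join s = span_val xi.
Proof.
pose J : {linear tens2 un1 un2 -> tens H} := HB.pack join
  (GRing.isLinear.Build _ _ _ _ _ join_linear).
have /spanP[n [a [v [vu ->]]]] := span_val_in xi.
have /choice[s sP] : forall k, exists s, join s = v k.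
  move=> k; have [x ux <-] := vu k.
  have m1 := mem_span (imageP (@tensp C I1 _) (sub_vec_unit (A := I1) ux)).
  have m2 := mem_span (imageP (@tensp C I2 _) (sub_vec_unit (A := I2) ux)).
  exists (tensp2 (SpanSpace m1 : un1) (SpanSpace m2 : un2)).
  by rewrite join_tensp2 tens_merge_tensp//= glue_vec_sub_vec.
exists (\sum_k a k *: s k); rewrite -[join _]/(J _) linear_sum.
by apply: eq_bigr => k _; rewrite linearZ /= sP.
Qed.

(** The form on the tensor product is pulled back along [join], which is then isometric by
    definition; definiteness of a tensor product of inner products makes [join] injective. *)
Lemma tens_un_split :
  let form1 (a b : un1) :=
    phi1_form (sub_ip ip I1) (span_val a) (span_val b) in
  let form2 (a b : un2) :=
    phi1_form (sub_ip ip I2) (span_val a) (span_val b) in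
  is_inner_product form1 -> is_inner_product form2 ->
  exists2 g : {dot (tens2 un1 un2) for Num.conj},
    is_tensor2_form form1 form2 g
  & exists Psi : {linear tens_un ip -> tens2 un1 un2},
    [/\ bijective Psi,
        (forall xi : tens_un ip, canonical_split I1 I2 (span_val xi) =
           tens2_map (fun a : un1 => span_val a)
                     (fun b : un2 => span_val b) (Psi xi))
      & (forall xi eta : tens_un ip,
           g (Psi xi) (Psi eta) = phi1_form ip (span_val xi) (span_val eta))].
Proof.
move=> form1 form2 [d1 d1E] [d2 d2E].
pose g0 s s' := phi1_form ip (join s) (join s').
have g0h : hermitian_form g0.
  have [l h] := phi1_form_hermitian ip.
  by split=> [y a u v|x y]; rewrite /g0 ?join_linear ?l// h.
have g0t a a' b b' : g0 (tensp2 a b) (tensp2 a' b') = form1 a a' * form2 b b'.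
  by rewrite /g0 !join_tensp2 phi1_form_tens_merge.
have g0d s : 0 <= g0 s s /\ (g0 s s = 0 -> s = 0).
  apply: (@tens2_dot_definite _ _ _ d1 d2) => // a a' b b'.
  by rewrite -d1E -d2E; exact: g0t.
have [|||g gE] := @is_inner_productP _ _ g0; rewrite //; do ?by move=> s; case: (g0d s).
exists g; first by move=> a a' b b'; rewrite -gE; exact: g0t.
have joinI : injective join.
  move=> s s' ss'; apply/eqP; rewrite -subr_eq0; apply/eqP.
  apply: (g0d _).2; rewrite /g0.
  have -> : join (s - s') = 0.
    by rewrite addrC -scaleN1r join_linear ss' scaleN1r addNr.
  by have [f ->] := hermitian_formP (phi1_form_hermitian ip); rewrite linear0l.
have /choice[psi psiE] := join_surj.
(* [psi] is only a choice of preimages; injectivity of [join] makes it linear. *)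
have psi_linear : linear psi.
  by move=> a u v; apply: joinI; rewrite join_linear !psiE span_valP.
pose Psi : {linear tens_un ip -> tens2 un1 un2} := HB.pack psi
  (GRing.isLinear.Build _ _ _ _ _ psi_linear).
exists Psi; split=> [|xi|xi eta].
- exists (fun s => SpanSpace (join_un s)) => [xi|s]; last by apply: joinI; rewrite psiE.
  by apply: span_val_inj; rewrite /= psiE.
(* Splitting undoes the merge inside [join (psi xi)] and leaves [emb (psi xi)]. *)
- by rewrite -psiE /join (tens_merge2K U12 D12).
- by rewrite -gE /g0 !psiE.
Qed.
End UnitTensorSplit.

(** * Assembly of the three claims *)

Theorem lemma4p2 (R : realType) (I : choiceType) (H : I -> lmodType R[i])
    (ip : forall i, {dot (H i) for Num.conj})
    (infinite_I : infinite_set [set: I])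
    (nonzero_H : forall i, exists x : H i, x != 0) :
  [/\
    (forall mu : set (forall i, H i), Omega_un ip mu ->
       (exists g : {dot (tens_mu mu) for Num.conj}, is_product_form ip g)
       /\ (forall g : {dot (tens_mu mu) for Num.conj}, is_product_form ip g ->
             forall xi eta : tens_mu mu,
               phi1_form ip (span_val xi) (span_val eta) = g xi eta)),
    [/\ is_positive_sesquilinear
          (fun xi eta : tens_ct ip => phi1_form ip (span_val xi) (span_val eta)),
        is_inner_product
          (fun xi eta : tens_un ip => phi1_form ip (span_val xi) (span_val eta)),
        (forall u : tens_un ip, exists v : tens_ct ip, span_val v = span_val u)
      & (forall z : tens_ct ip, exists! p : tens_ct ip * tens_un ip,
           ct_radical p.1 /\ span_val z = span_val p.1 + span_val p.2)]
  & (forall I1 I2 : set I,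
       I1 !=set0 -> I2 !=set0 -> [set: I] = I1 `|` I2 -> I1 `&` I2 = set0 ->
       let un1 := tens_un (sub_ip ip I1) in
       let un2 := tens_un (sub_ip ip I2) in
       let form1 (a b : un1) :=
         phi1_form (sub_ip ip I1) (span_val a) (span_val b) in
       let form2 (a b : un2) :=
         phi1_form (sub_ip ip I2) (span_val a) (span_val b) in
       [/\ is_inner_product form1, is_inner_product form2,
           bijective (canonical_split (H := H) I1 I2)
         & exists2 g : {dot (tens2 un1 un2) for Num.conj},
             is_tensor2_form form1 form2 g
           & exists Psi : {linear tens_un ip -> tens2 un1 un2},
             [/\ bijective Psi,
                 (forall xi : tens_un ip,
                    canonical_split I1 I2 (span_val xi) =
                    tens2_map (fun a : un1 => span_val a)
                              (fun b : un2 => span_val b) (Psi xi))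
               & (forall xi eta : tens_un ip,
                    g (Psi xi) (Psi eta) =
                    phi1_form ip (span_val xi) (span_val eta))]])].
Proof.
have un_un t : (@tensp _ I H @` unit_vecs ip) t ->
    t \in Defs.span (@tensp _ I H @` unit_vecs ip) by exact: mem_span.
have inner_un := phi1_form_inner_product un_un.
have herm := phi1_form_hermitian ip.
split.
- move=> mu mu_un.
  have mu_in t : (@tensp _ I H @` prod_mu mu) t ->
      t \in Defs.span (@tensp _ I H @` unit_vecs ip).
    by move=> [x xmu <-]; exact: (prod_mu_un nonzero_H mu_un xmu).
  have [g gE] := phi1_form_inner_product mu_in.
  split=> [|h hP xi eta].
    exists g => xi eta x y xmu ymu xiE etaE.
    by rewrite -gE xiE etaE; exact: (phi1_form_prod_mu mu_un).
  (* Hermitian forms on a span are determined on generators, where both take the product value. *)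
  move: xi eta; apply: span_space_form_ext.
  + exact: hermitian_form_span.
  + exact: hermitian_form_dot.
  + move=> u v [x xmu xE] [y ymu yE]; rewrite -xE -yE (phi1_form_prod_mu mu_un)//.
    by rewrite (hP u v x y).
- split.
  + split.
      have [g gE] := hermitian_formP
        (@hermitian_form_span _ _ (@tensp _ I H @` ball_vecs ip) _ herm).
      by exists g => x y; exact: (congr1 (fun f => f x y) gE).
    move=> xi; have [u uun ux] := ct_decomposition nonzero_H (span_val_in xi).
    have [g gE] := hermitian_formP herm.
    (* The component [span_val xi - u] is orthogonal to the ball span, so the form of [xi] with
       itself is that of [u]. *)
    have xiE : span_val xi = (span_val xi - u) + u by rewrite subrK.
    have uct := un_ct uun.
    rewrite {2}xiE gE linearDr /= -gE ux ?span_val_in// add0r.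
    rewrite {1}xiE gE linearDl /= -gE herm.2 ux// rmorph0 add0r.
    by case: (phi1_form_un uun).
  + exact: inner_un.
  + by move=> u; exists (SpanSpace (un_ct (span_val_in u))).
  + move=> z; have [u uun ux] := ct_decomposition nonzero_H (span_val_in z).
    have [g gE] := hermitian_formP herm.
    have kct : span_val z - u \in Defs.span (@tensp _ I H @` ball_vecs ip).
      by rewrite rpredB ?span_val_in// un_ct.
    exists (SpanSpace kct, SpanSpace uun); split=> /=.
      by split; [move=> x; apply: ux; exact: span_val_in|rewrite subrK].
    move=> [k' u'] /= [k'r zE].
    (* Two decompositions differ by a vector lying both in the unit span and in the radical;
       definiteness makes it 0. *)
    have dE : span_val u' - u = (span_val z - u) - span_val k'.
      by rewrite zE addrAC [span_val k' + _]addrC addrK.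
    have dun : span_val u' - u \in Defs.span (@tensp _ I H @` unit_vecs ip).
      by rewrite rpredB// span_val_in.
    have d0 : span_val u' - u = 0.
      apply: (phi1_form_un dun).2; pose d := SpanSpace (un_ct dun) : tens_ct ip.
      rewrite {2}dE gE linearBr /= -gE ux; last exact: un_ct.
      by rewrite (k'r d) subrr.
    have u'E : span_val u' = u by apply/eqP; rewrite -subr_eq0 d0.
    congr (_, _); apply: span_val_inj; rewrite /= -?u'E//.
    by rewrite zE addrK.
- move=> I1 I2 _ _ /esym U12 D12 un1 un2 form1 form2.
  have in1 : is_inner_product form1.
    by apply: phi1_form_inner_product => t; exact: mem_span.
  have in2 : is_inner_product form2.
    by apply: phi1_form_inner_product => t; exact: mem_span.
  split=> //; last exact: tens_un_split.
  exists (tens_merge2 U12); [exact: canonical_splitK|exact: tens_merge2K].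
Qed.
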